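(* Let $(F_0)_i,(F_0)_i^\dagger,(F_\infty)_j,(F_\infty)_j^\dagger$ ($i,j=1,\dots,m$) be the fermionic fields defined in the context. Then $$\left\langle (F_\infty)_j^\dagger\,(F_0)_i\right\rangle=\frac{1}{sn(a_2+b_i-c_j)}=\left\langle (F_\infty)_j\,(F_0)_i^\dagger\right\rangle,$$ where $\langle\cdot\rangle$ is the vacuum expectation value.
   Context: Parameters. $A,B,C$ are linear operators on $\mathbb{C}^m$ with $A+B+C=0$, $\operatorname{rank}B=\operatorname{rank}C=m$, $A$ diagonalizable with two different eigenvalues $a_1$ (multiplicity $1$) and $a_2$ (multiplicity $m-1$), generic within these restrictions; $B$ has eigenvalues $b_i$ and eigenvectors $v_i$, $C$ has eigenvalues $-c_i$ and eigenvectors $w_i$, uniquely scaled so that $\sum v_i=\sum w_i=u$, where $u$ is an eigenvector of $A$ for $a_1$. The eigenvalues are generic subject to $a_1+(m-1)a_2+\sum(b_i-c_i)=0$. Put $V$: $e_i\mapsto v_i$; $X_{ij}=\frac1{b_j-b_i}$ ($i\ne j$), $X_{ii}=-\sum_{j\ne i}\frac1{b_j-b_i}$; $S=VXV^{-1}$; $v_i(\tau)=e^{S\tau}v_i$, $w_i(\tau)=e^{-S\tau}w_i$; $\mu_i^2(\tau)=\prod_k(a_2+b_k-c_i+\tau)/\prod_{k\ne i}(c_k-c_i)$, $\nu_i^2(\tau)=\prod_k(a_2+b_i-c_k+\tau)/\prod_{k\ne i}(b_i-b_k)$. $H_{\tau_1,\tau_2}$ is a copy of $\mathbb{C}^m$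 with the bases $v_i(\tau_1)$, $w_i(\tau_2)$ and the symmetric product $(\cdot,\cdot)_{\tau_1,\tau_2}$ satisfying $(v_i(\tau_1),v_j(\tau_1))_{\tau_1,\tau_2}=\delta_{ij}\nu_i^2(\tau_1+\tau_2)$, $(w_i(\tau_2),w_j(\tau_2))_{\tau_1,\tau_2}=\delta_{ij}\mu_i^2(\tau_1+\tau_2)$, $(v_i(\tau_1),w_j(\tau_2))_{\tau_1,\tau_2}=\frac{\nu_i^2(\tau_1+\tau_2)\mu_j^2(\tau_1+\tau_2)}{a_2+b_i-c_j+\tau_1+\tau_2}$. Fields. $\omega_1,\omega_2$ are linearly independent complex numbers, $\Omega=\mathbb{Z}\omega_1+\mathbb{Z}\omega_2$, $\tau_1=n_1\omega_1$, $\tau_2=n_2\omega_2$. In $H_{\tau_1,\tau_2}\oplus H_{\tau_2,\tau_1}$ put $(f_0)_i(\tau_1,\tau_2)=\frac{1}{\nu_i^2(\tau_1+\tau_2)}\frac{v_i(\tau_1)\oplus\sqrt{-1}v_i(\tau_2)}{\sqrt2}$, $(f_\infty)_i(\tau_1,\tau_2)=\frac{1}{\mu_i^2(\tau_1+\tau_2)}\frac{w_i(\tau_2)\oplus\sqrt{-1}w_i(\tau_1)}{\sqrt2}$, and let $(f_0)_i^\dagger$, $(f_\infty)_i^\dagger$ be given by the same formulas with $\oplus\sqrt{-1}$ replaced by $\oplus-\sqrt{-1}$. The space $H_{\tau_1,\tau_2}\oplus H_{\tau_2,\tau_1}$ carries the modified symmetric product: for $\tau_1+\tau_2\neq0$,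 $$(g_1\oplus g_2,h_1\oplus h_2)=(-1)^{n_1}\Big((g_1,h_1)_{\tau_1,\tau_2}+(g_2,h_2)_{\tau_2,\tau_1}-\tfrac{1}{\tau_1+\tau_2}\big((u,g_1)_{\tau_1,\tau_2}(u,h_1)_{\tau_1,\tau_2}+(u,g_2)_{\tau_2,\tau_1}(u,h_2)_{\tau_2,\tau_1}\big)\Big),$$ and for $\tau_1+\tau_2=0$, $(g_1\oplus g_2,h_1\oplus h_2)=(g_1,h_1)_{\tau_1,\tau_2}+(g_2,h_2)_{\tau_2,\tau_1}$. Let $H=\bigoplus_{\tau_1+\tau_2\in\Omega}H_{\tau_1,\tau_2}\oplus H_{\tau_2,\tau_1}$ (orthogonal direct sum) and let $CA$ be the Clifford algebra generated by $H$ with relations $fh+hf=(f,h)$. The vacuum expectation value of a product of two elements $f,h\in H$ is $\langle fh\rangle=(f,h)$; it is extended bilinearly to formal series. The fermionic fields are $(F_0)_i(z_1,z_2)=\sum (f_0)_i(\tau_1,\tau_2)z_1^{n_1}z_2^{n_2}$, $(F_0)_i^\dagger(z_1,z_2)=\sum (f_0)_i^\dagger(\tau_1,\tau_2)z_1^{n_1}z_2^{n_2}$, $(F_\infty)_i(z_1,z_2)=\sum (f_\infty)_i(\tau_1,\tau_2)z_1^{-n_1}z_2^{-n_2}$, $(F_\infty)_i^\dagger(z_1,z_2)=\sum (f_\infty)_i^\dagger(\tau_1,\tau_2)z_1^{-n_1}z_2^{-n_2}$, sums over $\tau_1+\tau_2\in\Omega$; in the expectation values both fields are taken at the same $(z_1,z_2)$.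 Elliptic sine: $\frac{1}{sn(z)}=\sqrt{\mathcal{P}(z)-e_3}$, where $\mathcal P$ is the Weierstrass function of the lattice $\Omega$, $e_3=\mathcal P(\omega_2/2)$, and the branch is the one with $1/sn(z)\sim 1/z$ at $z=0$ (no further normalization of periods is imposed). *)

(* Defs.v *)
From HB Require Import structures.
From mathcomp Require Import all_boot all_order all_algebra.
From mathcomp Require Import finmap complex.
From mathcomp Require Import all_classical all_reals all_analysis.

Set Implicit Arguments.
Unset Strict Implicit.
Unset Printing Implicit Defensive.

Import Order.TTheory GRing.Theory Num.Theory.
Import numFieldNormedType.Exports.

Local Open Scope classical_set_scope.
Local Open Scope ring_scope.

(* The complex numbers, typed as a numClosedFieldType so that the norm topology
   is inferred on them (it is not on the bare type complex R). *)
Definition Cplx (R : realType) : numClosedFieldType := complex R.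

(* The sum of t over the rectangle -p.1.1 <= n1 <= p.1.2, -p.2.1 <= n2 <= p.2.2. *)
Definition rect_sum (R : realType) (t : int -> int -> Cplx R)
    (p : (nat * nat) * (nat * nat)) : Cplx R :=
  \sum_(i < (p.1.1 + p.1.2).+1) \sum_(j < (p.2.1 + p.2.2).+1)
    t (i%:Z - p.1.1%:Z) (j%:Z - p.2.1%:Z).

Definition rect_filter : set_system ((nat * nat) * (nat * nat)) :=
  filter_prod (filter_prod \oo \oo) (filter_prod \oo \oo).

(* Convergence of a bilateral double series in the sense of Pringsheim: the four
   sides of the rectangle go to infinity independently. Absolute convergence is
   not required: the series of the vacuum expectation values below decay like
   (-1)^n1 / tau^2 and converge only conditionally. *)
Definition double_series_to (R : realType) (t : int -> int -> Cplx R)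
    (l : Cplx R) : Prop :=
  rect_sum t p @[p --> rect_filter] --> l.

Definition double_series (R : realType) (t : int -> int -> Cplx R) : Cplx R :=
  lim (rect_sum t p @[p --> rect_filter]).

Definition period (R : realType) (w1 w2 : Cplx R) (n1 n2 : int) : Cplx R :=
  n1%:~R * w1 + n2%:~R * w2.

Definition lattice (R : realType) (w1 w2 : Cplx R) : set (Cplx R) :=
  [set z | exists n1 n2 : int, z = period w1 w2 n1 n2].

(* Linear independence over the real numbers, i.e. the lattice has rank 2. *)
Definition R_independent (R : realType) (w1 w2 : Cplx R) : Prop :=
  forall s t : R,
    (real_complex R s : Cplx R) * w1 + (real_complex R t : Cplx R) * w2 = 0 ->
    s = 0 /\ t = 0.

Definition weierstrass_p (R : realType) (w1 w2 z : Cplx R) : Cplx R :=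
  z ^- 2 + double_series (fun n1 n2 =>
    let tau := period w1 w2 n1 n2 in
    if tau == 0 then 0 else (z - tau) ^- 2 - tau ^- 2).

(* A branch of sqrt (P(z) - e3) on the complement of the lattice, with
   e3 = P(w2 / 2), equivalent to 1 / z at 0. As the complement of the lattice and
   of the zeros w2 / 2 + lattice is connected, there is only one. *)
Definition inv_sn_branch (R : realType) (w1 w2 : Cplx R) :
    set (Cplx R -> Cplx R) :=
  [set g | [/\ forall z, ~ lattice w1 w2 z ->
                 g z ^+ 2 = weierstrass_p w1 w2 z - weierstrass_p w1 w2 (w2 / 2),
               forall z, ~ lattice w1 w2 z -> {for z, continuous g}
             & z * g z @[z --> 0^'] --> (1 : Cplx R)]].

Definition elliptic_sn (R : realType) (w1 w2 z : Cplx R) : Cplx R :=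
  (get (inv_sn_branch w1 w2) z)^-1.

Definition expmx (R : realType) (m : nat) (M : 'M[Cplx R]_m) : 'M[Cplx R]_m :=
  lim (series (fun k => (k`!%:R)^-1 *: M ^+ k) @ \oo).

(* Operators act on column vectors. *)
Record operators (R : realType) (m : nat) (A B C : 'M[Cplx R]_m)
    (a1 a2 : Cplx R) (b c : 'I_m -> Cplx R) (v w : 'I_m -> 'cV[Cplx R]_m)
    (u : 'cV[Cplx R]_m) : Prop := Operators {
  op_sum : A + B + C = 0;
  op_rankB : \rank B = m;
  op_rankC : \rank C = m;
  op_diagA : diagonalizable A;
  op_a12 : a1 != a2;
  op_charA : char_poly A = ('X - a1%:P) * ('X - a2%:P) ^+ m.-1;
  op_eigB : forall i, v i != 0 /\ B *m v i = b i *: v i;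
  op_eigC : forall i, w i != 0 /\ C *m w i = - c i *: w i;
  op_sumv : \sum_i v i = u;
  op_sumw : \sum_i w i = u;
  op_eigA : u != 0 /\ A *m u = a1 *: u;
  op_trace : a1 + m.-1%:R * a2 + \sum_i (b i - c i) = 0
}.

(* What genericity of the eigenvalues is needed for: every denominator in the
   definitions below, and every norm mu_i^2(tau), nu_i^2(tau) with tau in the
   lattice, is nonzero. *)
Record generic_eigenvalues (R : realType) (m : nat) (w1 w2 : Cplx R)
    (a2 : Cplx R) (b c : 'I_m -> Cplx R) : Prop := GenericEigenvalues {
  gen_b : injective b;
  gen_c : injective c;
  gen_abc : forall i j n1 n2, a2 + b i - c j + period w1 w2 n1 n2 != 0
}.

Definition Xmx (R : realType) (m : nat) (b : 'I_m -> Cplx R) : 'M[Cplx R]_m :=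
  \matrix_(i, j) if i == j then - \sum_(k | k != i) (b k - b i)^-1
                 else (b j - b i)^-1.

Definition Vmx (R : realType) (m : nat) (v : 'I_m -> 'cV[Cplx R]_m) :
    'M[Cplx R]_m :=
  \matrix_(k, i) v i k 0.

Definition Smx (R : realType) (m : nat) (b : 'I_m -> Cplx R)
    (v : 'I_m -> 'cV[Cplx R]_m) : 'M[Cplx R]_m :=
  Vmx v *m Xmx b *m invmx (Vmx v).

Definition vt (R : realType) (m : nat) (b : 'I_m -> Cplx R)
    (v : 'I_m -> 'cV[Cplx R]_m) (i : 'I_m) (tau : Cplx R) : 'cV[Cplx R]_m :=
  expmx (tau *: Smx b v) *m v i.

Definition wt (R : realType) (m : nat) (b : 'I_m -> Cplx R)
    (v w : 'I_m -> 'cV[Cplx R]_m) (i : 'I_m) (tau : Cplx R) : 'cV[Cplx R]_m :=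
  expmx (- tau *: Smx b v) *m w i.

(* mu2 and nu2 stand for the squares mu_i^2 and nu_i^2. *)
Definition mu2 (R : realType) (m : nat) (a2 : Cplx R) (b c : 'I_m -> Cplx R)
    (i : 'I_m) (tau : Cplx R) : Cplx R :=
  (\prod_k (a2 + b k - c i + tau)) / \prod_(k | k != i) (c k - c i).

Definition nu2 (R : realType) (m : nat) (a2 : Cplx R) (b c : 'I_m -> Cplx R)
    (i : 'I_m) (tau : Cplx R) : Cplx R :=
  (\prod_k (a2 + b i - c k + tau)) / \prod_(k | k != i) (b i - b k).

(* Q is the symmetric product of the copy H_{t1,t2} of C^m. *)
Record is_symprod (R : realType) (m : nat) (a2 : Cplx R)
    (b c : 'I_m -> Cplx R) (v w : 'I_m -> 'cV[Cplx R]_m) (t1 t2 : Cplx R)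
    (Q : {symmetric 'cV[Cplx R]_m}) : Prop := IsSymprod {
  symprod_vv : forall i j, Q (vt b v i t1) (vt b v j t1) =
    (i == j)%:R * nu2 a2 b c i (t1 + t2);
  symprod_ww : forall i j, Q (wt b v w i t2) (wt b v w j t2) =
    (i == j)%:R * mu2 a2 b c i (t1 + t2);
  symprod_vw : forall i j, Q (vt b v i t1) (wt b v w j t2) =
    nu2 a2 b c i (t1 + t2) * mu2 a2 b c j (t1 + t2) /
      (a2 + b i - c j + t1 + t2)
}.

(* The summand of index n = (n1, n2) is H_{t1,t2} (+) H_{t2,t1}, with t1 = n1 w1
   and t2 = n2 w2; both components are copies of C^m, so its elements are pairs
   of column vectors. This is the modified symmetric product on it. *)
Definition summand_form (R : realType) (m : nat) (w1 w2 : Cplx R)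
    (u : 'cV[Cplx R]_m) (Q : Cplx R -> Cplx R -> {symmetric 'cV[Cplx R]_m})
    (n : int * int) (g h : 'cV[Cplx R]_m * 'cV[Cplx R]_m) : Cplx R :=
  let t1 := n.1%:~R * w1 in
  let t2 := n.2%:~R * w2 in
  if t1 + t2 == 0 then Q t1 t2 g.1 h.1 + Q t2 t1 g.2 h.2
  else (-1) ^ n.1 *
    (Q t1 t2 g.1 h.1 + Q t2 t1 g.2 h.2
     - (t1 + t2)^-1 * (Q t1 t2 u g.1 * Q t1 t2 u h.1
                       + Q t2 t1 u g.2 * Q t2 t1 u h.2)).

Definition Hspace (R : realType) (m : nat) : Type :=
  {fsfun (int * int) -> ('cV[Cplx R]_m * 'cV[Cplx R]_m) with (0, 0)}.

(* The element g of the summand of index n, seen in H. *)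
Definition homogeneous (R : realType) (m : nat) (n : int * int)
    (g : 'cV[Cplx R]_m * 'cV[Cplx R]_m) : Hspace R m :=
  [fsfun x in [fset n]%fset => g | (0, 0)].

(* Different summands are orthogonal; the terms outside the support of f vanish. *)
Definition Hform (R : realType) (m : nat) (w1 w2 : Cplx R)
    (u : 'cV[Cplx R]_m) (Q : Cplx R -> Cplx R -> {symmetric 'cV[Cplx R]_m})
    (f h : Hspace R m) : Cplx R :=
  \sum_(n <- finsupp f) summand_form w1 w2 u Q n (f n) (h n).

(* The elements (f_0)_i and (f_oo)_i for eps = 'i; their daggers for eps = - 'i. *)
Definition f0 (R : realType) (m : nat) (w1 w2 a2 : Cplx R)
    (b c : 'I_m -> Cplx R) (v : 'I_m -> 'cV[Cplx R]_m)
    (eps : Cplx R) (i : 'I_m) (n1 n2 : int) : Hspace R m :=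
  let t1 := n1%:~R * w1 in
  let t2 := n2%:~R * w2 in
  let s := (nu2 a2 b c i (t1 + t2))^-1 / sqrtC 2 in
  homogeneous (n1, n2) (s *: vt b v i t1, s *: (eps *: vt b v i t2)).

Definition foo (R : realType) (m : nat) (w1 w2 a2 : Cplx R)
    (b c : 'I_m -> Cplx R) (v w : 'I_m -> 'cV[Cplx R]_m)
    (eps : Cplx R) (i : 'I_m) (n1 n2 : int) : Hspace R m :=
  let t1 := n1%:~R * w1 in
  let t2 := n2%:~R * w2 in
  let s := (mu2 a2 b c i (t1 + t2))^-1 / sqrtC 2 in
  homogeneous (n1, n2) (s *: wt b v w i t2, s *: (eps *: wt b v w i t1)).

(* A formal series sum_(k1, k2) F_(k1, k2) z1^k1 z2^k2, infinite in all
   directions, is given by its coefficients. *)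
Definition formal_series (T : Type) : Type := int -> int -> T.

Definition constant_series (R : realType) (x : Cplx R) :
    formal_series (Cplx R) :=
  fun k1 k2 => if (k1 == 0) && (k2 == 0) then x else 0.

Definition F0 (R : realType) (m : nat) (w1 w2 a2 : Cplx R)
    (b c : 'I_m -> Cplx R) (v : 'I_m -> 'cV[Cplx R]_m) (i : 'I_m) :
    formal_series (Hspace R m) :=
  fun n1 n2 => f0 w1 w2 a2 b c v 'i i n1 n2.

Definition F0_dag (R : realType) (m : nat) (w1 w2 a2 : Cplx R)
    (b c : 'I_m -> Cplx R) (v : 'I_m -> 'cV[Cplx R]_m) (i : 'I_m) :
    formal_series (Hspace R m) :=
  fun n1 n2 => f0 w1 w2 a2 b c v (- 'i) i n1 n2.

Definition Foo (R : realType) (m : nat) (w1 w2 a2 : Cplx R)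
    (b c : 'I_m -> Cplx R) (v w : 'I_m -> 'cV[Cplx R]_m) (i : 'I_m) :
    formal_series (Hspace R m) :=
  fun k1 k2 => foo w1 w2 a2 b c v w 'i i (- k1) (- k2).

Definition Foo_dag (R : realType) (m : nat) (w1 w2 a2 : Cplx R)
    (b c : 'I_m -> Cplx R) (v w : 'I_m -> 'cV[Cplx R]_m) (i : 'I_m) :
    formal_series (Hspace R m) :=
  fun k1 k2 => foo w1 w2 a2 b c v w (- 'i) i (- k1) (- k2).

(* The vacuum expectation value < f h > of the product of two generators f, h of
   the Clifford algebra, which is (f, h) by definition; no other elements of the
   Clifford algebra are needed. *)
Definition vev (R : realType) (m : nat) (w1 w2 : Cplx R)
    (u : 'cV[Cplx R]_m) (Q : Cplx R -> Cplx R -> {symmetric 'cV[Cplx R]_m})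
    (f h : Hspace R m) : Cplx R :=
  Hform w1 w2 u Q f h.

(* < F G > = Phi for formal series F, G in the same variables z1, z2: the
   coefficient of z1^k1 z2^k2 in the bilinear extension of vev is the sum of
   < F_p G_(k-p) > over p in Z x Z. *)
Definition vev_series_eq (R : realType) (m : nat) (w1 w2 : Cplx R)
    (u : 'cV[Cplx R]_m) (Q : Cplx R -> Cplx R -> {symmetric 'cV[Cplx R]_m})
    (F G : formal_series (Hspace R m)) (Phi : formal_series (Cplx R)) : Prop :=
  forall k1 k2 : int,
    double_series_to
      (fun p1 p2 => vev w1 w2 u Q (F p1 p2) (G (k1 - p1) (k2 - p2)))
      (Phi k1 k2).

(* Main.v *)
Require Import Defs.
From HB Require Import structures.
From mathcomp Require Import all_boot all_order all_algebra.
From mathcomp Require Import finmap complex.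
From mathcomp Require Import all_classical all_reals all_analysis.
From mathcomp Require Import ring lra zify.

Set Implicit Arguments.
Unset Strict Implicit.
Unset Printing Implicit Defensive.

Import Order.TTheory GRing.Theory Num.Theory.
Import numFieldNormedType.Exports.

Local Open Scope classical_set_scope.
Local Open Scope ring_scope.

(* Each expectation is the sum over the lattice of (-1)^n1 (1/(x + tau) - 1/tau),
   x = a2 + b_i - c_j: since S u = 0, u is the sum of the v_i(t) and of the w_i(t)
   for all t. Averaging neighbours in the direction w1 makes this sum absolutely
   convergent; call it g(x). That g^2 - P is constant is proved without complex
   analysis: in the product of the partial sums for g(z) and g(z + a), partial
   fractions turn the double sum into a single sum whose weights tend to g(a),
   plus the partial sum of P(z) when a = 0. If g(a) = 0 (e.g. a = 0, where the
   convention 1/0 = 0 makes g odd), the differences of g(z) g(z + a) between two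
   values of z are therefore those of P, or 0. With g(w2/2) = 0 this gives
   g^2 = P - e3; for a outside half the lattice it shows that g has no other zeros,
   so the branch of the square root is unique by connectedness. *)

(** The weights of the single sum tend to [g a] only for each fixed index, and the terms they
    multiply, 1/(z + tau) - 1/(z + a - tau), are merely of order 1/|tau|. Subtracting the same
    expression at a second point z' improves the order to |tau|^-3, because the two fractions move
    in opposite directions when z changes; then dominated convergence for sums applies. This is why
    only differences between two values of z are computed, and why a zero of g is needed to fix the
    constant. The sign (-1)^n1 alternates along w1 and is constant along w2. Hence the averaging
    along w1, and hence the zero at w2/2, where the reflection of the lattice preserves the signs:
    this selects e3 among the values of P at half-periods. Passing from S u = 0 to exp(t S) u = u
    requires the value of a limit of matrices. It is available because S is nilpotent: X lowers the
    degree of polynomials in the b_i, so the exponential series is eventually constant. *)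

(** * The complex modulus with real values *)

Section ComplexModulus.
Context {R : realType}.
Implicit Types x y z : Cplx R.

(** The norm of [Cplx R] takes its values in [Cplx R] itself. A modulus in [R] keeps all estimates
    in a totally ordered field, within reach of [lra] and [nra]. *)
Definition cabs z : R := ComplexField.Normc.normc z.

Lemma normE z : `|z| = real_complex R (cabs z).
Proof. by []. Qed.

Lemma cabsM x y : cabs (x * y) = cabs x * cabs y.
Proof. exact: ComplexField.Normc.normcM. Qed.

Lemma cabs0 : cabs 0 = 0.
Proof. exact: ComplexField.Normc.normc0. Qed.

Lemma cabs1 : cabs 1 = 1.
Proof. exact: ComplexField.Normc.normc1. Qed.

Lemma cabs_ge0 z : 0 <= cabs z.
Proof. by rewrite /cabs; case: z => a b /=; rewrite sqrtr_ge0. Qed.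

Lemma cabs_eq0 z : (cabs z == 0) = (z == 0).
Proof.
apply/eqP/eqP => [|->]; last exact: cabs0.
exact: ComplexField.Normc.eq0_normc.
Qed.

Lemma cabs_gt0 z : (0 < cabs z) = (z != 0).
Proof. by rewrite lt0r cabs_ge0 andbT cabs_eq0. Qed.

Lemma cabsN z : cabs (- z) = cabs z.
Proof. by apply: complexI; rewrite -!normE normrN. Qed.

Lemma cabsD x y : cabs (x + y) <= cabs x + cabs y.
Proof. by have := ler_normD x y; rewrite !normE -rmorphD lecR. Qed.

Lemma cabsB x y : cabs (x - y) <= cabs x + cabs y.
Proof. by rewrite -(cabsN y); exact: cabsD. Qed.

Lemma cabs_ge x y : cabs x - cabs y <= cabs (x + y).
Proof. by rewrite lerBlDr -{1}(addrK y x); exact: cabsB. Qed.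

Lemma cabsV z : cabs z^-1 = (cabs z)^-1.
Proof.
have [->|z0] := eqVneq z 0; first by rewrite invr0 cabs0 invr0.
have a0 : cabs z != 0 by rewrite cabs_eq0.
by apply: (mulfI a0); rewrite -cabsM !divff// cabs1.
Qed.

Lemma cabsX z n : cabs (z ^+ n) = cabs z ^+ n.
Proof. by elim: n => [|n IH]; rewrite ?expr0 ?cabs1// !exprS cabsM IH. Qed.

Lemma cabs_nat n : cabs n%:R = n%:R.
Proof.
by apply: complexI; rewrite -normE normr_nat rmorph_nat.
Qed.

Lemma cabs_sum (I : Type) (r : seq I) (P : pred I) (F : I -> Cplx R) :
  cabs (\sum_(i <- r | P i) F i) <= \sum_(i <- r | P i) cabs (F i).
Proof.
elim/big_rec2: _ => [|i s z _ le_zs]; first by rewrite cabs0.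
by apply: le_trans (cabsD _ _) _; rewrite lerD2l.
Qed.

Lemma cabs_real (t : R) : cabs (real_complex R t) = `|t|.
Proof. by rewrite /cabs /= expr0n addr0 sqrtr_sqr. Qed.

Lemma Re_le_cabs z : `|complex.Re z| <= cabs z.
Proof. by rewrite -lecR -normE; exact: normc_ge_Re. Qed.

Lemma Im_le_cabs z : `|complex.Im z| <= cabs z.
Proof.
rewrite /cabs; case: z => a b /=; rewrite -(sqrtr_sqr b) ler_sqrt.
  by rewrite lerDr sqr_ge0.
by rewrite addr_ge0 ?sqr_ge0.
Qed.

Lemma nbhs_cabs z (P : Cplx R -> Prop) :
  (\forall y \near z, P y) <->
  exists2 e : R, 0 < e & forall y, cabs (y - z) < e -> P y.
Proof.
split=> [/nbhs_ballP [e /= e0 eP]|[e e0 eP]].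
  have e_real : real_complex R (complex.Re e) = e by apply: RRe_real; rewrite gtr0_real.
  exists (complex.Re e); first by rewrite -ltcR e_real.
  move=> y yz; apply: eP; rewrite /ball /= distrC normE.
  by rewrite -e_real ltcR.
apply/nbhs_ballP; exists (real_complex R e); first by rewrite /= ltcR.
by move=> y; rewrite /ball /= distrC normE ltcR; exact: eP.
Qed.

Lemma cvg_cabsP (T : Type) (F : set_system T) {FF : Filter F}
    (f : T -> Cplx R) (l : Cplx R) :
  f @ F --> l <-> (forall e : R, 0 < e -> \forall x \near F, cabs (f x - l) < e).
Proof.
split=> [fl e e0|fl].
  by apply: (fl [set y | cabs (y - l) < e]); apply/nbhs_cabs; exists e.
move=> A /nbhs_cabs [e e0 eA].
by apply: filterS (fl e e0) => x; exact: eA.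
Qed.

End ComplexModulus.

(** * Limit rules for complex-valued functions *)

Section ComplexLimits.
Context {R : realType} (T : Type) (F : set_system T) {FF : Filter F}.
Implicit Types (f h : T -> Cplx R) (k l : Cplx R).

Lemma cplx_cvgD f h k l : f x @[x --> F] --> k -> h x @[x --> F] --> l ->
  f x + h x @[x --> F] --> k + l.
Proof. exact: cvgD. Qed.

Lemma cplx_cvgB f h k l : f x @[x --> F] --> k -> h x @[x --> F] --> l ->
  f x - h x @[x --> F] --> k - l.
Proof. exact: cvgB. Qed.

Lemma cplx_cvgM f h k l : f x @[x --> F] --> k -> h x @[x --> F] --> l ->
  f x * h x @[x --> F] --> k * l.
Proof. exact: cvgM. Qed.

Lemma cplx_cvgV f k : k != 0 -> f x @[x --> F] --> k ->
  (f x)^-1 @[x --> F] --> k^-1.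
Proof. exact: cvgV. Qed.

Lemma cplx_cvg_cst k : k @[_ --> F] --> k.
Proof. exact: cvg_cst. Qed.

Lemma cplx_near_cvg f h l :
  (\forall x \near F, f x = h x) -> f x @[x --> F] --> l -> h x @[x --> F] --> l.
Proof.
move=> fh /cvg_cabsP fl; apply/cvg_cabsP => e e0.
by apply: filterS2 fh (fl e e0) => x ->.
Qed.

End ComplexLimits.
Arguments cplx_cvg_cst {R T F FF} k.

(** * Unconditional sums and dominated convergence *)

Section UnconditionalSums.
Context {R : realType} {I : choiceType}.
Implicit Types (A B : {fset I}) (f g : I -> Cplx R) (M : I -> R).

(** Limits along finite index sets ordered by inclusion do not depend on an enumeration. Both
    rectangles and squares of indices converge to this filter by [cvg_totally], so one notion of sum
    serves for all of them. *)
Definition totally : set_system {fset I} :=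
  filter_from setT (fun A => [set B | (A `<=` B)%fset]).

Global Instance totally_filter : ProperFilter totally.
Proof.
eapply filter_from_proper; last by move=> A _; exists A; rewrite /= fsubset_refl.
apply: filter_fromT_filter; first by exists fset0.
by move=> A B /=; exists (A `|` B)%fset => P /=; rewrite fsubUset => /andP[].
Qed.

Lemma cvg_totally (T : Type) (F : set_system T) {FF : Filter F} (B : T -> {fset I}) :
  (forall n, \forall x \near F, n \in B x) -> B @ F --> totally.
Proof.
move=> inB S [A _ AS]; have : \forall x \near F, {subset enum_fset A <= B x}.
  elim: (enum_fset A) => [|n r IH]; first by apply: filterE => x.
  apply: filterS2 (inB n) IH => x nB rB m.
  by rewrite inE => /predU1P[->|/rB].
by apply: filterS => x /fsubsetP; exact: AS.
Qed.

Definition has_sum f (l : Cplx R) :=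
  (\sum_(n <- A) f n) @[A --> totally] --> l.

Definition bounded_sums M := exists K : R, forall A, \sum_(n <- A) M n <= K.

Lemma has_sumP f l : has_sum f l <->
  forall e : R, 0 < e -> exists A, forall B, (A `<=` B)%fset ->
    cabs (\sum_(n <- B) f n - l) < e.
Proof.
rewrite /has_sum cvg_cabsP; split=> H e e0.
  by have [A _ HA] := H e e0; exists A => B; exact: HA.
by have [A HA] := H e e0; exists A => // B; exact: HA.
Qed.

Lemma has_sum_unique f l l' : has_sum f l -> has_sum f l' -> l = l'.
Proof. by move=> fl fl'; apply: cvg_unique fl fl'; exact: norm_hausdorff. Qed.

Lemma has_sumD f g l l' : has_sum f l -> has_sum g l' ->
  has_sum (fun n => f n + g n) (l + l').
Proof.
move=> fl gl; rewrite /has_sum; under eq_fun do rewrite big_split/=.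
exact: (cvgD (fl : _ --> _) (gl : _ --> _)).
Qed.

Lemma has_sumZ (c : Cplx R) f l : has_sum f l ->
  has_sum (fun n => c * f n) (c * l).
Proof.
move=> fl; rewrite /has_sum; under eq_fun do rewrite -mulr_sumr.
exact: (cvgM (cvg_cst c) (fl : _ --> _)).
Qed.

Lemma has_sumB f g l l' : has_sum f l -> has_sum g l' ->
  has_sum (fun n => f n - g n) (l - l').
Proof.
move=> fl gl; have := has_sumD fl (@has_sumZ (-1) _ _ gl); rewrite mulN1r.
by under eq_fun do rewrite mulN1r.
Qed.

Lemma has_sum_fin f A : (forall n, n \notin A -> f n = 0) ->
  has_sum f (\sum_(n <- A) f n).
Proof.
move=> f0; apply/has_sumP => e e0; exists A => B AB.
by rewrite (big_fset_incl _ AB) ?subrr ?cabs0// => n _ /f0.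
Qed.

Lemma has_sum_reindex (phi psi : I -> I) f l : cancel phi psi -> cancel psi phi ->
  has_sum f l -> has_sum (fun n => f (phi n)) l.
Proof.
move=> phiK psiK /has_sumP fl; apply/has_sumP => e /fl[A HA].
exists [fset psi n | n in A]%fset => B AB.
have := HA [fset phi n | n in B]%fset.
rewrite big_imfset/=; last by move=> x y _ _; exact: can_inj phiK x y.
apply; apply/fsubsetP => n nA; apply/imfsetP; exists (psi n) => //=.
by apply: (fsubsetP AB); apply/imfsetP; exists n.
Qed.

Lemma fsum_split (V : zmodType) (F : I -> V) A B : (A `<=` B)%fset ->
  \sum_(n <- B) F n = \sum_(n <- A) F n + \sum_(n <- B | n \notin A) F n.
Proof.
move=> AB; rewrite (bigID (mem A))/=; congr (_ + _).
rewrite -big_filter; apply: perm_big; apply: uniq_perm.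
- by rewrite filter_uniq.
- by [].
- by move=> n; rewrite mem_filter andb_idr// => /(fsubsetP AB).
Qed.

(** Sums over several translates of [A] become sums over one set [B] with 0/1 weights, and can then
    be added term by term. *)
Lemma fsum_shift A B (h h' : I -> I) (F : I -> Cplx R) :
  cancel h h' -> cancel h' h -> {in A, forall i, h i \in B} ->
  \sum_(i <- B) (h' i \in A)%:R * F i = \sum_(i <- A) F (h i).
Proof.
move=> hK h'K hS.
have -> : \sum_(i <- A) F (h i) = \sum_(i <- [fset h i | i in A]%fset) F i.
  by rewrite big_imfset//= => i j _ _; exact: can_inj hK i j.
have sub : ([fset h i | i in A] `<=` B)%fset.
  by apply/fsubsetP => _ /imfsetP[i /= nS ->]; exact: hS.
rewrite (fsum_split _ sub) [X in _ + X]big1 ?addr0; last first.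
  move=> i; apply: contraNeq; case: (boolP (h' i \in _)) => [h'i _|]; last first.
    by rewrite mul0r eqxx.
  by apply/imfsetP; exists (h' i) => //=; rewrite h'K.
by apply: eq_big_seq => _ /imfsetP[i /= nS ->]; rewrite hK nS mul1r.
Qed.

Lemma fsum_tail M : (forall n, 0 <= M n) -> bounded_sums M ->
  forall e, 0 < e -> exists A, forall B, \sum_(n <- B | n \notin A) M n < e.
Proof.
move=> M0 [K MK] e e0; pose S := [set \sum_(n <- A) M n | A in [set: {fset I}]].
have supS : has_sup S.
  split; first by exists (\sum_(n <- fset0 : {fset I}) M n), fset0.
  by exists K => _ [A _ <-]; exact: MK.
have [_ [A _ <-] ltA] := sup_adherent e0 supS.
exists A => B; have AAB := fsubsetUl A B.
have : \sum_(n <- (A `|` B)%fset) M n <= sup S.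
  by apply: sup_upper_bound => //; exists (A `|` B)%fset.
rewrite (fsum_split _ AAB) => le_sup.
suff -> : \sum_(n <- B | n \notin A) M n =
    \sum_(n <- (A `|` B)%fset | n \notin A) M n by lra.
rewrite -big_filter -[RHS]big_filter; apply: perm_big.
apply: uniq_perm; rewrite ?filter_uniq// => n.
by rewrite !mem_filter in_fsetU; case: (n \in A).
Qed.

Lemma ge0_sum_exists M : (forall n, 0 <= M n) -> bounded_sums M ->
  exists s, forall e, 0 < e -> exists A, forall B, (A `<=` B)%fset ->
    `|\sum_(n <- B) M n - s| < e.
Proof.
move=> M0 [K MK]; pose S := [set \sum_(n <- A) M n | A in [set: {fset I}]].
have supS : has_sup S.
  split; first by exists (\sum_(n <- fset0 : {fset I}) M n), fset0.
  by exists K => _ [A _ <-]; exact: MK.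
exists (sup S) => e e0; have [_ [A _ <-] ltA] := sup_adherent e0 supS.
exists A => B AB; rewrite ltr_norml.
have B_S : \sum_(n <- B) M n <= sup S by apply: sup_upper_bound => //; exists B.
have : 0 <= \sum_(n <- B | n \notin A) M n by apply: sumr_ge0.
by move: B_S; rewrite (fsum_split _ AB); lra.
Qed.

Lemma real_sum_exists (M : I -> R) : bounded_sums (fun n => `|M n|) ->
  exists s, forall e, 0 < e -> exists A, forall B, (A `<=` B)%fset ->
    `|\sum_(n <- B) M n - s| < e.
Proof.
move=> bM; have [s1 H1] := ge0_sum_exists (fun n => normr_ge0 (M n)) bM.
have [||s2 H2] := @ge0_sum_exists (fun n => `|M n| + M n).
- by move=> n; have := ler_norm (- M n); rewrite normrN; lra.
- case: bM => K MK; exists (K + K) => A; rewrite big_split/= lerD//.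
  by apply: le_trans (MK A); apply: ler_sum => n _; exact: ler_norm.
exists (s2 - s1) => e e0; have e2 : 0 < e / 2 by lra.
have [A1 HA1] := H1 _ e2; have [A2 HA2] := H2 _ e2.
exists (A1 `|` A2)%fset => B; rewrite fsubUset => /andP[/HA1 {}HA1 /HA2].
rewrite big_split/= => {}HA2.
have -> : \sum_(n <- B) M n - (s2 - s1) =
  (\sum_(n <- B) `|M n| + \sum_(n <- B) M n - s2) - (\sum_(n <- B) `|M n| - s1) by lra.
by apply: le_lt_trans (ler_normB _ _) _; lra.
Qed.

Lemma has_sum_exists f : bounded_sums (fun n => cabs (f n)) ->
  exists l, has_sum f l.
Proof.
move=> [K fK].
have part (p : Cplx R -> R) : (forall z, `|p z| <= cabs z) ->
    bounded_sums (fun n => `|p (f n)|).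
  move=> ple; exists K => A; apply: le_trans (fK A).
  by apply: ler_sum => n _; exact: ple.
have [a Ha] := real_sum_exists (part _ Re_le_cabs).
have [b Hb] := real_sum_exists (part _ Im_le_cabs).
pose i := 'i%C : Cplx R.
exists (real_complex R a + i * real_complex R b).
apply/has_sumP => e e0; have e2 : 0 < e / 2 by lra.
have [A1 HA1] := Ha _ e2; have [A2 HA2] := Hb _ e2.
exists (A1 `|` A2)%fset => B; rewrite fsubUset => /andP[/HA1 {}HA1 /HA2 {}HA2].
have -> : \sum_(n <- B) f n = real_complex R (\sum_(n <- B) complex.Re (f n))
    + i * real_complex R (\sum_(n <- B) complex.Im (f n)).
  rewrite !rmorph_sum mulr_sumr -big_split/=.
  by apply: eq_bigr => n _; rewrite -complexE.
rewrite opprD addrACA -mulrBr -!rmorphB.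
apply: le_lt_trans (cabsD _ _) _; rewrite cabsM !cabs_real.
have -> : cabs i = 1 by rewrite /cabs /= expr0n expr1n add0r sqrtr1.
by lra.
Qed.

Lemma bounded_sums_le M M' A : (forall n, 0 <= M n) -> bounded_sums M ->
  (forall n, n \notin A -> M' n <= M n) -> bounded_sums M'.
Proof.
move=> M0 [K MK] le_M; exists (\sum_(n <- A) `|M' n| + K) => B.
rewrite (bigID (mem A))/= lerD//.
  apply: le_trans (_ : \sum_(n <- B | n \in A) `|M' n| <= _).
    by apply: ler_sum => n _; exact: ler_norm.
  have -> : \sum_(n <- B | n \in A) `|M' n| = \sum_(n <- (A `&` B)%fset) `|M' n|.
    rewrite -big_filter; apply: perm_big.
    by apply: uniq_perm; rewrite ?filter_uniq// => n; rewrite mem_filter in_fsetI.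
  by rewrite [leRHS](fsum_split _ (fsubsetIl A B)) lerDl sumr_ge0.
apply: le_trans (MK B); rewrite [leRHS](bigID (mem A))/=.
rewrite (le_trans (_ : _ <= \sum_(n <- B | n \notin A) M n))//.
  exact: ler_sum.
by rewrite lerDr sumr_ge0.
Qed.

(** Dominated convergence for series. The finite set [A] is exempt from the majorant, which leaves
    room for terms that have a pole at the limit point. *)
Lemma tannery (T : Type) (F : set_system T) {FF : ProperFilter F}
    (f : T -> I -> Cplx R) (l : I -> Cplx R) M A (s : T -> Cplx R) (t : Cplx R) :
  (forall n, 0 <= M n) -> bounded_sums M ->
  (\forall x \near F, forall n, n \notin A -> cabs (f x n) <= M n) ->
  (forall n, f x n @[x --> F] --> l n) ->
  (\forall x \near F, has_sum (f x) (s x)) -> has_sum l t ->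
  s @ F --> t.
Proof.
move=> M0 bM f_M f_l f_s l_t.
(* The majorant passes to the limit, so the tails of [l] are as small as those of [f x]. *)
have l_M n : n \notin A -> cabs (l n) <= M n.
  move=> nA; rewrite leNgt; apply/negP => Mn.
  have /cvg_cabsP/(_ (cabs (l n) - M n)) := f_l n.
  rewrite subr_gt0 => /(_ Mn) near_l.
  have [x [/(_ _ nA) ?]] := filter_ex (filterI f_M near_l).
  have := cabs_ge (l n) (f x n - l n); rewrite [l n + _]addrC subrK; lra.
apply/cvg_cabsP => e e0; have e5 : 0 < e / 5 by lra.
have [A1 tailM] := fsum_tail M0 bM e5; set A2 := (A `|` A1)%fset.
have tail h B : (forall n, n \notin A -> cabs (h n) <= M n) ->
    cabs (\sum_(n <- B | n \notin A2) h n) < e / 5.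
  move=> h_M; apply: le_lt_trans (cabs_sum _ _ _) _.
  apply: le_lt_trans (tailM B).
  rewrite big_mkcond [leRHS]big_mkcond/=; apply: ler_sum => n _.
  rewrite in_fsetU negb_or; case: (boolP (n \in A)) => [_|nA] /=.
    by case: ifP.
  by case: ifP => // _; exact: h_M.
have fin : (\sum_(n <- A2) f x n) @[x --> F] --> \sum_(n <- A2) l n.
  by apply: cvg_big => [|n _]; [exact: add_continuous|exact: f_l].
have {}fin := (cvg_cabsP _ _).1 fin _ e5.
near=> x.
have /has_sumP/(_ _ e5) [B1 HB1] : has_sum (f x) (s x) by near: x.
have /has_sumP/(_ _ e5) [B2 HB2] := l_t.
pose B := (A2 `|` (B1 `|` B2))%fset.
have A2B : (A2 `<=` B)%fset by exact: fsubsetUl.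
have /HB1 : (B1 `<=` B)%fset by rewrite /B fsubsetU// fsubsetUl orbT.
have /HB2 : (B2 `<=` B)%fset by rewrite /B fsubsetU// fsubsetUr orbT.
rewrite !(fsum_split _ A2B); have := tail l B l_M.
have : cabs (\sum_(n <- B | n \notin A2) f x n) < e / 5 by apply: tail; near: x.
have : cabs (\sum_(n <- A2) f x n - \sum_(n <- A2) l n) < e / 5 by near: x; exact: fin.
set fA := \sum_(n <- A2) f x n; set lA := \sum_(n <- A2) l n.
set fB := \sum_(n <- B | _) f x n; set lB := \sum_(n <- B | _) l n.
move=> h1 h2 h3 h4 h5.
(* Five errors of size e / 5: the finite part, the two tails, and the distances of the two partial
   sums to their limits. *)
have -> : s x - t = (fA - lA) + fB - lB + (lA + lB - t) - (fA + fB - s x) by ring.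
have := cabsB (fA - lA + fB - lB + (lA + lB - t)) (fA + fB - s x).
have := cabsD (fA - lA + fB - lB) (lA + lB - t).
have := cabsB (fA - lA + fB) lB; have := cabsD (fA - lA) fB.
by lra.
Unshelve. all: by end_near.
Qed.

Definition tsum f : Cplx R := get [set l | has_sum f l].

Lemma tsumP f : bounded_sums (fun n => cabs (f n)) -> has_sum f (tsum f).
Proof.
by move=> /has_sum_exists[l fl]; apply: (@getPex _ [set l | has_sum f l]); exists l.
Qed.

Lemma tsumE f l : has_sum f l -> tsum f = l.
Proof.
move=> fl; apply: (has_sum_unique _ fl).
by apply: (@getPex _ [set l | has_sum f l]); exists l.
Qed.

End UnconditionalSums.

(** * The matrix X is nilpotent, and exp(t S) fixes u *)

Section NilpotentExponential.
Context {R : realType}.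

Section Vandermonde.
Context (F : fieldType) (m : nat) (b : 'I_m -> F).

Definition power_mx : 'M[F]_m := \matrix_(i, k) b i ^+ k.

Lemma power_mx_unit : injective b -> power_mx \in unitmx.
Proof.
move=> b_inj; rewrite -unitmx_tr.
have -> : power_mx^T = Vandermonde m (\row_i b i).
  by apply/matrixP => i j; rewrite !mxE.
rewrite unitmxE unitfE det_Vandermonde.
apply/prodf_neq0 => i _; apply/prodf_neq0 => j ij.
by rewrite !mxE subr_eq0; apply: contraTneq ij => /b_inj ->; rewrite ltnn.
Qed.

(** In the monomial basis, the operator sending p(x) to the sum over j of the divided differences
    (p(b_j) - p(x)) / (b_j - x), minus p'(x). The derivative removes the term j = i when x = b_i; it
    is the entry k at l = k - 1. *)
Definition divided_difference_mx : 'M[F]_m :=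
  \matrix_(l, k) if (l < k)%N then
    \sum_j b j ^+ (k.-1 - l) - (if l == k.-1 :> nat then k%:R else 0) else 0.

End Vandermonde.

(** Applying every power of [B] to a linear relation between the [v i], and reading a coordinate
    where one of them is nonzero, gives a vector annihilated by the Vandermonde matrix of [b]. *)
Lemma eigenvectors_unit (m : nat) (B : 'M[Cplx R]_m) (b : 'I_m -> Cplx R)
    (v : 'I_m -> 'cV[Cplx R]_m) : injective b ->
  (forall i, v i != 0 /\ B *m v i = b i *: v i) -> Vmx v \in unitmx.
Proof.
move=> b_inj eig; rewrite -unitmx_tr -row_free_unit; apply: inj_row_free => x xV.
have sum0 : \sum_i x 0 i *: v i = 0.
  apply/matrixP => k j; rewrite summxE (ord1 j) mxE.
  have /matrixP/(_ 0 k) := xV; rewrite !mxE => E; rewrite -[RHS]E.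
  by apply: eq_bigr => i _; rewrite !mxE.
have pow0 k : \sum_i (x 0 i * b i ^+ k) *: v i = 0.
  elim: k => [|k IH]; first by under eq_bigr do rewrite expr0 mulr1.
  have := congr1 (mulmx B) IH; rewrite mulmx0 mulmx_sumr => E; rewrite -[RHS]E.
  apply: eq_bigr => i _; rewrite -scalemxAr (eig i).2 scalerA.
  by rewrite exprSr mulrA.
apply/matrixP => z i; rewrite (ord1 z) [RHS]mxE {z}; have [vi0 _] := eig i.
have /eqP/matrix0Pn [k [z]] := elimN eqP vi0; rewrite (ord1 z) => vik.
pose r : 'rV[Cplx R]_m := \row_j (x 0 j * v j k 0).
have /(congr1 (fun M => M *m invmx (power_mx b))) : r *m power_mx b = 0.
  apply/matrixP => z' l; rewrite (ord1 z') !mxE.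
  have /matrixP/(_ k 0) := pow0 l; rewrite summxE mxE => E; rewrite -[RHS]E.
  by apply: eq_bigr => j _; rewrite !mxE; ring.
rewrite mulmxK ?power_mx_unit// mul0mx => /matrixP/(_ 0 i); rewrite !mxE.
by move=> /eqP; rewrite mulf_eq0 (negPf vik) orbF => /eqP.
Qed.

(** Since the rows of X sum to 0, X acts on a vector of values f_i by summing the quotients (f_j -
    f_i) / (b_j - b_i). On values of monomials these are divided differences, again polynomial in
    b_i. *)
Lemma Xmx_power (m : nat) (b : 'I_m -> Cplx R) : injective b ->
  Xmx b *m power_mx b = power_mx b *m divided_difference_mx b.
Proof.
move=> b_inj; apply/matrixP => i k; rewrite !mxE.
have -> : \sum_j Xmx b i j * power_mx b j k =
    \sum_(j | j != i) (b j ^+ k - b i ^+ k) / (b j - b i).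
  rewrite (bigD1 i)//= !mxE eqxx mulNr mulr_suml -sumrN -big_split/=.
  by apply: eq_bigr => j ji; rewrite !mxE eq_sym (negPf ji); ring.
have -> : \sum_(j | j != i) (b j ^+ k - b i ^+ k) / (b j - b i) =
    \sum_(j | j != i) \sum_(l < k) b j ^+ (k.-1 - l) * b i ^+ l.
  apply: eq_bigr => j ji; rewrite subrXX mulrAC divff ?mul1r.
    by apply: eq_bigr => l _; rewrite -subn1 -subnDA add1n.
  by rewrite subr_eq0 (inj_eq b_inj).
rewrite exchange_big/= (big_ord_widen m (fun l => \sum_(j | j != i)
  b j ^+ (k.-1 - l) * b i ^+ l)) ?(ltnW (ltn_ord k))// big_mkcond/=.
transitivity (\sum_(l < m) ((if (l < k)%N then \sum_j b j ^+ (k.-1 - l) * b i ^+ l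
   else 0) - (if (l < k)%N then b i ^+ k.-1 else 0))).
  apply: eq_bigr => l _; case: ifP => lk; last by rewrite subr0.
  have E : b i ^+ (k.-1 - l) * b i ^+ l = b i ^+ k.-1.
    by rewrite -exprD subnK// -ltnS prednK// (leq_ltn_trans _ lk).
  by rewrite [in RHS](bigD1 i)//= E addrAC subrr add0r.
(* The excluded index j = i accounts for k equal powers b_i^(k-1), now gathered at the single index
   l = k - 1. *)
transitivity (\sum_(l < m) ((if (l < k)%N then \sum_j b j ^+ (k.-1 - l) * b i ^+ l
   else 0) - (if (l < k)%N then (if l == k.-1 :> nat then k%:R else 0) * b i ^+ l
     else 0))).
  rewrite !sumrB; congr (_ - _); rewrite -!big_mkcond/=.
  rewrite -(big_ord_widen m (fun=> b i ^+ k.-1)) ?(ltnW (ltn_ord k))//.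
  rewrite -(big_ord_widen m (fun l => (if l == k.-1 then k%:R else 0) * b i ^+ l))
    ?(ltnW (ltn_ord k))//.
  case: (nat_of_ord k) => [|k']; first by rewrite !big_ord0.
  rewrite [RHS]big_ord_recr/=. rewrite [X in _ = X + _]big1 ?add0r; last first.
    move=> l _ /=. by rewrite ltn_eqF ?mul0r.
  by rewrite eqxx sumr_const card_ord mulr_natl.
apply: eq_bigr => l _; rewrite !mxE; case: ifP => lk; last by rewrite subr0 mulr0.
by rewrite -mulr_suml -mulrBl mulrC.
Qed.

(** The matrix is strictly upper triangular, so each factor moves at least one step further above
    the diagonal. *)
Lemma divided_difference_nilpotent (m : nat) (b : 'I_m -> Cplx R) n (l k : 'I_m) :
  (k < l + n)%N -> (divided_difference_mx b ^+ n) l k = 0.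
Proof.
elim: n l k => [|n IH] l k; first by rewrite addn0 expr0 mxE => kl; rewrite -val_eqE gtn_eqF.
move=> kln; rewrite exprSr mxE big1// => j _.
have [jk|kj] := ltnP j k; last by rewrite [X in _ * X]mxE ltnNge kj mulr0.
by rewrite IH ?mul0r//; lia.
Qed.

Lemma Xmx_nilpotent (m : nat) (b : 'I_m -> Cplx R) : injective b ->
  Xmx b ^+ m = 0.
Proof.
move=> b_inj; have Wu := power_mx_unit b_inj.
have XW n : Xmx b ^+ n *m power_mx b = power_mx b *m divided_difference_mx b ^+ n.
  elim: n => [|n IH]; first by rewrite !expr0 mul1mx mulmx1.
  by rewrite exprSr -mulmxA Xmx_power// mulmxA IH -mulmxA exprSr.
rewrite -[LHS](mulmxK Wu) XW.
suff -> : divided_difference_mx b ^+ m = 0 by rewrite mulmx0 mul0mx.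
apply/matrixP => l k; rewrite mxE; apply: divided_difference_nilpotent.
by rewrite ltn_addl.
Qed.

(** The partial sums of the exponential are constant from index m on, so the limit is a finite sum,
    of which only the zeroth term does not kill [x]. *)
Lemma expmx_nilpotent_fixed (m : nat) (M : 'M[Cplx R]_m) (x : 'cV[Cplx R]_m) :
  M ^+ m = 0 -> M *m x = 0 -> expmx M *m x = x.
Proof.
move=> Mm Mx; pose E : 'M[Cplx R]_m := series (fun k => (k`!%:R)^-1 *: M ^+ k) m.
have -> : expmx M = E.
  apply: lim_near_cst; first exact: norm_hausdorff.
  exists m => // k /= mk; rewrite /E /series/= (big_cat_nat _ mk)//=.
  rewrite [X in _ + X]big_nat_cond [X in _ + X]big1 ?addr0// => j /andP[/andP[mj _] _].
  by rewrite -(subnK mj) exprD Mm mulr0 scaler0.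
rewrite /E /series/= mulmx_suml.
have Mj j : (0 < j)%N -> M ^+ j *m x = 0.
  by case: j => // j _; rewrite exprSr -mulmxA Mx mulmx0.
case: m M x Mm Mx E Mj => [|m] M x Mm Mx E Mj.
  by apply/matrixP; case.
rewrite big_nat_recl//= big1 ?addr0; last first.
  by move=> j _; rewrite -scalemxAl Mj ?scaler0.
by rewrite fact0 invr1 scale1r mul1mx.
Qed.

Lemma expmx_S_fixed (m : nat) (B : 'M[Cplx R]_m) (b : 'I_m -> Cplx R)
    (v : 'I_m -> 'cV[Cplx R]_m) (t : Cplx R) : injective b ->
  (forall i, v i != 0 /\ B *m v i = b i *: v i) ->
  expmx (t *: Smx b v) *m \sum_i v i = \sum_i v i.
Proof.
move=> b_inj eig; have Vu := eigenvectors_unit b_inj eig.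
have S_exp n : (Smx b v) ^+ n = Vmx v *m Xmx b ^+ n *m invmx (Vmx v).
  elim: n => [|n IH]; first by rewrite !expr0 mulmx1 mulmxV.
  by rewrite !exprSr IH /Smx -!mulmxE !mulmxA mulmxKV.
have tS_exp n : (t *: Smx b v) ^+ n = t ^+ n *: (Smx b v) ^+ n.
  elim: n => [|n IH]; first by rewrite !expr0 scale1r.
  by rewrite !exprSr IH -!mulmxE -scalemxAl -scalemxAr scalerA.
apply: expmx_nilpotent_fixed.
  by rewrite tS_exp S_exp Xmx_nilpotent// mulmx0 mul0mx scaler0.
(* In the basis [v] the vector u has all coordinates 1, and X kills it because its rows sum to 0. *)
have -> : \sum_i v i = Vmx v *m const_mx 1.
  apply/matrixP => k j; rewrite summxE mxE (ord1 j).
  by apply: eq_bigr => i _; rewrite !mxE mulr1.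
rewrite -scalemxAl /Smx -!mulmxA (mulmxA (invmx _)) mulVmx// mul1mx.
suff -> : Xmx b *m const_mx 1 = 0 :> 'cV_m by rewrite mulmx0 scaler0.
apply/matrixP => i j; rewrite !mxE (bigD1 i)//= !mxE eqxx mulr1.
apply/eqP; rewrite addrC subr_eq0; apply/eqP/eq_bigr => k ki.
by rewrite !mxE eq_sym (negPf ki) mulr1.
Qed.

End NilpotentExponential.

(** * The expectation of one pair of modes *)

Section VacuumExpectation.
Context {R : realType} (m : nat).
Implicit Types (Q : {symmetric 'cV[Cplx R]_m}) (x y : 'cV[Cplx R]_m).

Lemma symprodC Q x y : Q x y = Q y x.
Proof. by rewrite hermC expr0 mul1r. Qed.

Lemma symprodZl Q s x y : Q (s *: x) y = s * Q x y.
Proof. exact: linearZl_LR. Qed.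

Lemma symprodZr Q s x y : Q x (s *: y) = s * Q x y.
Proof. by rewrite symprodC symprodZl symprodC. Qed.

Context (a2 : Cplx R) (b c : 'I_m -> Cplx R) (v w : 'I_m -> 'cV[Cplx R]_m)
  (u : 'cV[Cplx R]_m).

Lemma symprod_uv t1 t2 Q i : is_symprod a2 b c v w t1 t2 Q ->
  u = \sum_k vt b v k t1 -> Q u (vt b v i t1) = nu2 a2 b c i (t1 + t2).
Proof.
move=> HQ ->; rewrite linear_sumlz (bigD1 i)//= big1 ?addr0 => [|k ki].
  by rewrite (symprod_vv HQ) eqxx mul1r.
by rewrite (symprod_vv HQ) (negPf ki) mul0r.
Qed.

Lemma symprod_uw t1 t2 Q i : is_symprod a2 b c v w t1 t2 Q ->
  u = \sum_k wt b v w k t2 -> Q u (wt b v w i t2) = mu2 a2 b c i (t1 + t2).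
Proof.
move=> HQ ->; rewrite linear_sumlz (bigD1 i)//= big1 ?addr0 => [|k ki].
  by rewrite (symprod_ww HQ) eqxx mul1r.
by rewrite (symprod_ww HQ) (negPf ki) mul0r.
Qed.

Context (w1 w2 : Cplx R) (Q : Cplx R -> Cplx R -> {symmetric 'cV[Cplx R]_m}).

Lemma Hform_homogeneous n g (h : Hspace R m) :
  Hform w1 w2 u Q (homogeneous n g) h = summand_form w1 w2 u Q n g (h n).
Proof.
have gn : homogeneous n g n = g by rewrite fsfun_fun inE eqxx.
rewrite /Hform (@big_fset_incl _ _ _ _ _ [fset n]%fset).
- by rewrite big_seq_fset1 gn.
- apply/fsubsetP => k; rewrite mem_finsupp inE fsfun_fun inE.
  by case: ifP => //; rewrite eqxx.
- move=> k _; rewrite memNfinsupp => /eqP ->.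
  by rewrite /summand_form/= !linear0l !linear0r !(mul0r, mulr0, addr0, subr0) if_same.
Qed.

Lemma summand_form0 n g : summand_form w1 w2 u Q n g (0, 0) = 0.
Proof. by rewrite /summand_form/= !linear0r !(mulr0, addr0, subr0) if_same. Qed.

Lemma vev_foo_f0_eq0 eps eps' i j n1 n2 k1 k2 : (n1, n2) != (k1, k2) ->
  vev w1 w2 u Q (foo w1 w2 a2 b c v w eps j n1 n2)
    (f0 w1 w2 a2 b c v eps' i k1 k2) = 0.
Proof.
by move=> nk; rewrite /vev Hform_homogeneous fsfun_fun inE (negPf nk) summand_form0.
Qed.

Context (A B C : 'M[Cplx R]_m) (a1 : Cplx R).
Hypothesis hw : R_independent w1 w2.
Hypothesis hABC : operators A B C a1 a2 b c v w u.
Hypothesis hgen : generic_eigenvalues w1 w2 a2 b c.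
Hypothesis hQ12 : forall n1 n2 : int,
  is_symprod a2 b c v w (n1%:~R * w1) (n2%:~R * w2) (Q (n1%:~R * w1) (n2%:~R * w2)).
Hypothesis hQ21 : forall n1 n2 : int,
  is_symprod a2 b c v w (n2%:~R * w2) (n1%:~R * w1) (Q (n2%:~R * w2) (n1%:~R * w1)).

Lemma sum_vt t : u = \sum_k vt b v k t.
Proof.
by rewrite -mulmx_sumr (expmx_S_fixed _ (gen_b hgen) (op_eigB hABC)) (op_sumv hABC).
Qed.

Lemma sum_wt t : u = \sum_k wt b v w k t.
Proof.
rewrite -mulmx_sumr (op_sumw hABC) -(op_sumv hABC).
by rewrite (expmx_S_fixed _ (gen_b hgen) (op_eigB hABC)).
Qed.

Lemma period_eq0 n1 n2 : period w1 w2 n1 n2 = 0 -> n1 = 0 /\ n2 = 0.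
Proof.
move=> p0; have [|/eqP + /eqP] := hw (s := n1%:~R) (t := n2%:~R).
  by rewrite !rmorph_int.
by rewrite !intr_eq0 => /eqP ? /eqP.
Qed.

Lemma nu2_neq0 i n1 n2 : nu2 a2 b c i (period w1 w2 n1 n2) != 0.
Proof.
rewrite mulf_neq0// ?invr_eq0; apply/prodf_neq0 => k ki.
  exact: gen_abc.
by rewrite subr_eq0 (inj_eq (gen_b hgen)) eq_sym.
Qed.

Lemma mu2_neq0 i n1 n2 : mu2 a2 b c i (period w1 w2 n1 n2) != 0.
Proof.
rewrite mulf_neq0// ?invr_eq0; apply/prodf_neq0 => k ki.
  exact: gen_abc.
by rewrite subr_eq0 (inj_eq (gen_c hgen)).
Qed.

(** The condition on [eps] and [eps'] covers both daggered pairs: the two components then contribute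
    equally, half of the result each. As u is the sum of the v_i(t) and of the w_j(t), its products
    with them are nu^2 and mu^2, which the normalization cancels; this leaves the correction
    1/tau. *)
Lemma vev_foo_f0 eps eps' i j n1 n2 : eps * eps' = 1 ->
  vev w1 w2 u Q (foo w1 w2 a2 b c v w eps j n1 n2)
    (f0 w1 w2 a2 b c v eps' i n1 n2) =
  (-1) ^ n1 * ((a2 + b i - c j + period w1 w2 n1 n2)^-1
               - (period w1 w2 n1 n2)^-1).
Proof.
move=> eps1; rewrite /vev Hform_homogeneous fsfun_fun inE eqxx.
have q1 := symprod_vw (hQ12 n1 n2) i j.
have q2 := symprod_vw (hQ21 n1 n2) i j.
have q3 := symprod_uv i (hQ12 n1 n2) (sum_vt _).
have q4 := symprod_uv i (hQ21 n1 n2) (sum_vt _).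
have q5 := symprod_uw j (hQ12 n1 n2) (sum_wt _).
have q6 := symprod_uw j (hQ21 n1 n2) (sum_wt _).
rewrite symprodC in q1; rewrite symprodC in q2.
rewrite /summand_form/=; move: q1 q2 q3 q4 q5 q6.
rewrite /period; set t1 := n1%:~R * w1; set t2 := n2%:~R * w2.
rewrite (addrC t2 t1) -(addrA _ t2 t1) (addrC t2 t1) addrA.
move: (Q t1 t2) (Q t2 t1) (wt b v w j t1) (wt b v w j t2) => Qa Qb W2 W1.
move: (vt b v i t1) (vt b v i t2) => V1 V2 q1 q2 q3 q4 q5 q6.
rewrite !symprodZl !symprodZr q1 q2 q3 q4 q5 q6 {q1 q2 q3 q4 q5 q6}.
have := gen_abc hgen i j n1 n2; have := nu2_neq0 i n1 n2; have := mu2_neq0 j n1 n2.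
have := @period_eq0 n1 n2; rewrite /period -/t1 -/t2 addrA.
set nu := nu2 _ _ _ _ _; set mu := mu2 _ _ _ _ _.
set x := a2 + b i - c j + t1 + t2 => t0 mu0 nu0 x0.
have s20 : sqrtC 2 != 0 :> Cplx R by rewrite sqrtC_eq0 pnatr_eq0.
have s2E : sqrtC 2 * sqrtC 2 = 2 :> Cplx R by rewrite -expr2 sqrtCK.
have half : (sqrtC 2)^-1 * (sqrtC 2)^-1 = 2^-1 :> Cplx R by rewrite -invfM s2E.
set r := sqrtC 2 in s20 s2E half *.
have weight (y : Cplx R) : mu^-1 / r * (nu^-1 / r * (nu * mu * y)) = y / 2.
  by rewrite -half; field; rewrite ?nu0 ?mu0 ?s20.
have split2 (y : Cplx R) : y / 2 + y / 2 = y :> Cplx R by rewrite -splitr.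
have weps (y : Cplx R) : mu^-1 / r * (eps * (nu^-1 / r * (eps' * y))) =
    mu^-1 / r * (nu^-1 / r * y).
  by rewrite -[RHS]mul1r -eps1; ring.
rewrite !weps !weight.
(* At tau = 0 independence of the periods forces n1 = 0, so the sign is 1, and the absent correction
   agrees with the convention 1/0 = 0. *)
case: ifPn => [/eqP t0'|t1t2].
  have [-> _] := t0 t0'; rewrite t0' expr0z mul1r invr0 subr0.
  by rewrite split2.
congr (_ * _); rewrite split2; congr (_ - _).
have weps2 : mu^-1 / r * (eps * mu) * (nu^-1 / r * (eps' * nu)) =
    mu^-1 / r * mu * (nu^-1 / r * nu).
  by rewrite -[RHS]mul1r -eps1; ring.
have wt1 : mu^-1 / r * mu * (nu^-1 / r * nu) = 1 / 2.
  by rewrite -half; field; rewrite ?nu0 ?mu0 ?s20.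
by rewrite weps2 wt1 split2 mulr1.
Qed.

End VacuumExpectation.

(** * Sums over rectangles of Z x Z *)

Section LatticeSums.
Context {R : realType}.
Implicit Types (n : int * int) (a : R).

Definition rect (p : (nat * nat) * (nat * nat)) : {fset int * int} :=
  [fset ((nat_of_ord ij.1)%:Z - p.1.1%:Z, (nat_of_ord ij.2)%:Z - p.2.1%:Z)
    | ij in {: 'I_(p.1.1 + p.1.2).+1 * 'I_(p.2.1 + p.2.2).+1}]%fset.

Lemma in_rect p n : (n \in rect p) =
  ((- p.1.1%:Z <= n.1) && (n.1 <= p.1.2%:Z)) &&
  ((- p.2.1%:Z <= n.2) && (n.2 <= p.2.2%:Z)).
Proof.
case: p n => [[p1 p2] [q1 q2]] [n1 n2] /=; apply/imfsetP/idP => /= [|H].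
  by case=> -[[i /= hi] [j /= hj]] _ [-> ->]; lia.
have h1 : (absz (n1 + p1%:Z)%R < (p1 + p2).+1)%N by lia.
have h2 : (absz (n2 + q1%:Z)%R < (q1 + q2).+1)%N by lia.
by exists (Ordinal h1, Ordinal h2) => //=; congr (_, _); lia.
Qed.

Lemma big_rect (V : nmodType) p (f : int * int -> V) :
  \sum_(n <- rect p) f n =
  \sum_(i < (p.1.1 + p.1.2).+1) \sum_(j < (p.2.1 + p.2.2).+1)
    f (i%:Z - p.1.1%:Z, j%:Z - p.2.1%:Z).
Proof.
rewrite pair_big/= /rect big_imfset/=; last first.
  by move=> [i j] [i' j'] _ _ /= [/addIr [ii'] /addIr [jj']]; congr (_, _); exact: val_inj.
by rewrite big_enum.
Qed.

Lemma rect_sumE (t : int -> int -> Cplx R) p :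
  rect_sum t p = \sum_(n <- rect p) t n.1 n.2.
Proof. by rewrite big_rect. Qed.

Global Instance rect_filter_proper : ProperFilter rect_filter.
Proof. exact: filter_prod_proper. Qed.

Lemma rect_filter_ge N : \forall p \near rect_filter,
  [/\ (N <= p.1.1)%N, (N <= p.1.2)%N, (N <= p.2.1)%N & (N <= p.2.2)%N].
Proof.
have ge2 : filter_prod \oo \oo [set q : nat * nat | (N <= q.1)%N /\ (N <= q.2)%N].
  exists ([set i | (N <= i)%N], [set i | (N <= i)%N]); last by move=> [i j].
  by split; exists N.
exists ([set q : nat * nat | (N <= q.1)%N /\ (N <= q.2)%N],
        [set q : nat * nat | (N <= q.1)%N /\ (N <= q.2)%N]); first by split.
by move=> [[? ?] [? ?]] [/= [? ?] [? ?]].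
Qed.

Lemma rect_cvg : rect p @[p --> rect_filter] --> totally.
Proof.
apply: cvg_totally => n; apply: filterS (rect_filter_ge (`|n.1| + `|n.2|)) => p.
by rewrite in_rect; case: n => n1 n2 /= [? ? ? ?]; lia.
Qed.

Definition square N : {fset int * int} := rect ((N, N), (N, N)).

Lemma in_square N n : (n \in square N) = (`|n.1| <= N)%N && (`|n.2| <= N)%N.
Proof. by rewrite in_rect; case: n => n1 n2 /=; lia. Qed.

Definition nu n : R := (1 + `|n.1| + `|n.2|)%:R.

Lemma nu_ge1 n : 1 <= nu n.
Proof. by rewrite /nu ler1n. Qed.

Lemma nu_gt0 n : 0 < nu n.
Proof. exact: lt_le_trans ltr01 (nu_ge1 n). Qed.

(** Telescoping: x^-2 <= 2/x - 2/(x + 1) as soon as x >= 1. *)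
Lemma sum_inv2_le a N : 1 <= a -> \sum_(k < N) (a + k%:R) ^- 2 <= 2 / a.
Proof.
move=> a1; suff : \sum_(k < N) (a + k%:R) ^- 2 <= 2 / a - 2 / (a + N%:R).
  have : 0 <= 2 / (a + N%:R) by rewrite divr_ge0// addr_ge0//; lra.
  lra.
elim: N => [|N IH]; first by rewrite big_ord0 addr0 subrr.
rewrite big_ord_recr/= -[N.+1%:R]natr1 addrA; set x := a + N%:R in IH *.
have x1 : 1 <= x by rewrite /x -[1]addr0 lerD.
suff : x ^- 2 <= 2 / x - 2 / (x + 1) by lra.
have -> : 2 / x - 2 / (x + 1) = x ^- 2 * (2 * x / (x + 1)).
  by field; apply/andP; split; apply: lt0r_neq0; lra.
by rewrite ler_peMr ?invr_ge0 ?sqr_ge0// ler_pdivlMr; lra.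
Qed.

Lemma sum_inv3_le a N : 1 <= a -> \sum_(k < N) (a + k%:R) ^- 3 <= 2 / a ^+ 2.
Proof.
move=> a1; suff : \sum_(k < N) (a + k%:R) ^- 3 <= 2 / a ^+ 2 - 2 / (a + N%:R) ^+ 2.
  have : 0 <= 2 / (a + N%:R) ^+ 2 by rewrite divr_ge0// sqr_ge0.
  lra.
elim: N => [|N IH]; first by rewrite big_ord0 addr0 subrr.
rewrite big_ord_recr/= -[N.+1%:R]natr1 addrA; set x := a + N%:R in IH *.
have x1 : 1 <= x by rewrite /x -[1]addr0 lerD.
suff : x ^- 3 <= 2 / x ^+ 2 - 2 / (x + 1) ^+ 2 by lra.
have -> : 2 / x ^+ 2 - 2 / (x + 1) ^+ 2 =
    x ^- 3 * (2 * x * (2 * x + 1) / (x + 1) ^+ 2).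
  by field; apply/andP; split; apply: lt0r_neq0; lra.
rewrite ler_peMr ?invr_ge0 ?exprn_ge0//; first lra.
rewrite ler_pdivlMr; first nra.
by rewrite exprn_gt0//; lra.
Qed.

Lemma int_sum_le (phi : nat -> R) (s : R) p q : (forall k, 0 <= phi k) ->
  (forall N, \sum_(k < N) phi k <= s) ->
  \sum_(i < (p + q).+1) phi `|i%:Z - p%:Z|%N <= 2 * s.
Proof.
move=> phi0 phi_s; rewrite -(big_mkord xpredT (fun i : nat => phi `|i%:Z - p%:Z|%N)).
rewrite (big_cat_nat (n := p))//=; last by lia.
rewrite mulr_natl mulr2n lerD//.
  rewrite big_nat_rev/= add0n; apply: le_trans (phi_s p.+1).
  rewrite big_ord_recl/= -[leLHS]add0r lerD// -(big_mkord xpredT (fun i => phi i.+1)).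
  rewrite le_eqVlt; apply/orP; left; apply/eqP/eq_big_nat => i /andP[_ ip].
  by congr phi; lia.
rewrite -{1}[p]add0n big_addn; apply: le_trans (phi_s ((p + q).+1 - p)%N).
rewrite -(big_mkord xpredT) le_eqVlt; apply/orP; left; apply/eqP/eq_big_nat => i _.
by congr phi; lia.
Qed.

(** The bound does not depend on the length of the column. Boundary columns are therefore negligible
    however the other two sides of the rectangle grow, as Pringsheim convergence demands. *)
Lemma column_sum_le (n1 : int) p q :
  \sum_(j < (p + q).+1) nu (n1, j%:Z - p%:Z) ^- 2 <= 4 / (1 + `|n1|%N)%:R.
Proof.
have a1 : 1 <= (1 + `|n1|%N)%:R :> R by rewrite ler1n.
have := @int_sum_le (fun k => ((1 + `|n1|%N)%:R + k%:R) ^- 2) _ p q _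
  (fun N => sum_inv2_le N a1).
have -> : 2 * (2 / (1 + `|n1|%N)%:R) = 4 / (1 + `|n1|%N)%:R :> R by ring.
under eq_bigr do rewrite -natrD; apply.
by move=> k; rewrite invr_ge0 sqr_ge0.
Qed.

Lemma rect_nu3_le p : \sum_(n <- rect p) nu n ^- 3 <= 16.
Proof.
rewrite big_rect; apply: (@le_trans _ _
  (\sum_(i < (p.1.1 + p.1.2).+1) 4 * (1 + `|i%:Z - p.1.1%:Z|%:R) ^- 2)).
  apply: ler_sum => i _.
  have a1 : 1 <= (1 + `|i%:Z - p.1.1%:Z|%:R) :> R by rewrite lerDl.
  have := @int_sum_le (fun k => ((1 + `|i%:Z - p.1.1%:Z|%:R) + k%:R) ^- 3) _
    p.2.1 p.2.2 _ (fun N => sum_inv3_le N a1).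
  rewrite mulrA -natrM; under eq_bigr do rewrite -[1]/(1%:R) -!natrD; apply.
  by move=> k; rewrite invr_ge0 exprn_ge0// addr_ge0//; lra.
(* Each column gave 4 / (1 + |n1|)^2; summing over both signs of n1 costs a further factor 2 * 2,
   whence 16. *)
rewrite -mulr_sumr; have := @int_sum_le (fun k => (1 + k%:R) ^- 2) _
    p.1.1 p.1.2 _ (fun N => sum_inv2_le N (lexx 1)).
move=> /(_ _)/wrap[|]; last by lra.
by move=> k; rewrite invr_ge0 sqr_ge0.
Qed.

Lemma nu3_bounded (K : R) : bounded_sums (fun n => K * nu n ^- 3).
Proof.
pose L : R := Num.max K 0; have L0 : 0 <= L by rewrite le_max lexx orbT.
have KL : K <= L by rewrite le_max lexx.
have nu0 n : 0 <= nu n ^- 3 :> R by rewrite invr_ge0 exprn_ge0// ltW// nu_gt0.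
exists (L * 16) => A.
have near_A : \forall p \near rect_filter, (A `<=` rect p)%fset.
  by apply: (@rect_cvg [set B | (A `<=` B)%fset]); exists A.
have [p Ap] := filter_ex near_A.
have le1 : \sum_(n <- A) K * nu n ^- 3 <= \sum_(n <- rect p) L * nu n ^- 3.
  rewrite (fsum_split _ Ap) ler_wpDr ?sumr_ge0//; first by move=> n _; rewrite mulr_ge0.
  by apply: ler_sum => n _; rewrite ler_wpM2r.
apply: le_trans le1 _.
by rewrite -mulr_sumr ler_wpM2l// rect_nu3_le.
Qed.

End LatticeSums.

(** * The averaged lattice sum g *)

Section LatticeFunction.
Context {R : realType} (w1 w2 : Cplx R).
Hypothesis hw : R_independent w1 w2.
Implicit Types (n : int * int) (x y z a : Cplx R).

Local Notation nu := (@nu R).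

Definition lattice_pt n : Cplx R := period w1 w2 n.1 n.2.
Local Notation tau := lattice_pt.

Lemma tau0 : tau (0, 0) = 0.
Proof. by rewrite /lattice_pt /period !mul0r addr0. Qed.

Lemma tauD n k : tau (n.1 + k.1, n.2 + k.2) = tau n + tau k.
Proof. by rewrite /lattice_pt /period/= !rmorphD/=; ring. Qed.

Lemma tauN n : tau (- n.1, - n.2) = - tau n.
Proof. by rewrite /lattice_pt /period/= !rmorphN/=; ring. Qed.

Lemma tau_next n : tau (n.1 + 1, n.2) = tau n + w1.
Proof. by rewrite /lattice_pt /period/= rmorphD/=; ring. Qed.

Lemma tau_prev n : tau (n.1 - 1, n.2) = tau n - w1.
Proof. by rewrite /lattice_pt /period/= rmorphB/=; ring. Qed.

Lemma wronskian_neq0 :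
  complex.Im w1 * complex.Re w2 - complex.Re w1 * complex.Im w2 != 0.
Proof.
apply/eqP; case: w1 w2 hw => [a b] [c d] H /= D0.
have [|c0 a0] := H c (- a).
  by apply/eqP; rewrite eq_complex /= !mul0r !subr0 !addr0; apply/andP; split; apply/eqP; lra.
have [|d0 b0] := H d (- b).
  by apply/eqP; rewrite eq_complex /= !mul0r !subr0 !addr0; apply/andP; split; apply/eqP; lra.
have [|] := H 1 1; last by lra.
by apply/eqP; rewrite eq_complex /= !mul0r !subr0 !addr0; apply/andP; split; apply/eqP; lra.
Qed.

(** For z = s w1 + t w2, the imaginary part of z times the conjugate of w2 is s D, with D = Im (w1
    conj w2) nonzero; likewise t with w1. The summand 1 in the denominator makes its positivity
    immediate. *)
Lemma lattice_coercive : exists2 k : R, 0 < k & forall s t : R,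
  k * (`|s| + `|t|) <=
  cabs ((real_complex R s : Cplx R) * w1 + (real_complex R t : Cplx R) * w2).
Proof.
have D0 := wronskian_neq0.
set D := complex.Im w1 * _ - _ in D0.
have normJ (z : Cplx R) : cabs (conjc z : Cplx R) = cabs z.
  by apply: complexI; rewrite -!normE; exact: normcJ.
exists (`|D| / (1 + cabs w1 + cabs w2)) => [|s t].
  by rewrite divr_gt0 ?normr_gt0// -addrA ltr_pwDl// addr_ge0// cabs_ge0.
set z : Cplx R := _ + _; rewrite mulrAC ler_pdivrMr; last first.
  by rewrite -addrA ltr_pwDl// addr_ge0// cabs_ge0.
have : `|D| * `|s| <= cabs z * cabs w2.
  rewrite -normrM -(normJ w2) -cabsM; apply: le_trans (Im_le_cabs _).
  rewrite le_eqVlt; apply/orP; left; apply/eqP; congr (`|_|).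
  by rewrite /z /D; case: w1 w2 => [? ?] [? ?] /=; ring.
have : `|D| * `|t| <= cabs z * cabs w1.
  rewrite -normrM -(normJ w1) -cabsM; apply: le_trans (Im_le_cabs _).
  rewrite -normrN le_eqVlt; apply/orP; left; apply/eqP; congr (`|_|).
  by rewrite /z /D; case: w1 w2 => [? ?] [? ?] /=; ring.
have := cabs_ge0 z; nra.
Qed.

Lemma tau_coercive : exists2 k : R, 0 < k & forall n, k * (nu n - 1) <= cabs (tau n).
Proof.
have [k k0 H] := lattice_coercive; exists k => // n.
have := H n.1%:~R n.2%:~R; rewrite !rmorph_int; apply: le_trans.
suff -> : nu n - 1 = `|n.1%:~R| + `|n.2%:~R| :> R by [].
by rewrite /nu !natrD -!intr_norm -!abszE -!pmulrn; ring.
Qed.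

(* The translates of z by the nonzero periods avoid 0; z itself may be 0. *)
Definition regular z := forall n, n != (0, 0) -> z + tau n != 0.

(** The lower bound behind all estimates. Large periods dominate z by coercivity; the finitely many
    others are handled by continuity at z0. *)
Lemma nu_le z0 : regular z0 -> exists2 K : R, 0 < K &
  \forall z \near z0, forall n, n != (0, 0) -> nu n <= K * cabs (z + tau n).
Proof.
move=> z0_reg; have [k k0 kP] := tau_coercive.
have fin (r : seq (int * int)) : exists2 K : R, 0 < K & \forall z \near z0,
    forall n, n \in r -> n != (0, 0) -> nu n <= K * cabs (z + tau n).
  elim: r => [|n r [K K0 HK]]; first by exists 1 => //; exact: filterE.
  have [->|n0] := eqVneq n (0, 0).
    exists K => //; apply: filterS HK => z H n'.
    by rewrite inE => /orP[/eqP->|]; [rewrite eqxx|exact: H].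
  have d0 : 0 < cabs (z0 + tau n) by rewrite cabs_gt0 z0_reg.
  have nearn : \forall z \near z0, cabs (z0 + tau n) < 2 * cabs (z + tau n).
    apply/nbhs_cabs; exists (cabs (z0 + tau n) / 2); first by lra.
    move=> z zz0; have := cabs_ge (z0 + tau n) (z - z0).
    have -> : z0 + tau n + (z - z0) = z + tau n by ring.
    lra.
  pose Kn : R := 2 * nu n / cabs (z0 + tau n).
  have Kn0 : 0 < Kn by rewrite divr_gt0// mulr_gt0// nu_gt0.
  exists (K + Kn); first by lra.
  apply: filterS2 HK nearn => z H Hn n'; rewrite inE => /orP[/eqP->|n'r] n'0.
    have : nu n <= Kn * cabs (z + tau n).
      rewrite /Kn mulrAC ler_pdivlMr//; have := @nu_gt0 R n; nra.
    have := cabs_ge0 (z + tau n); nra.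
  have := H _ n'r n'0; have := cabs_ge0 (z + tau n'); nra.
pose rho := cabs z0 + 1.
(* From this size of nu on, k (nu - 1) - rho is at least k nu / 2. *)
have [N HN] : exists N : nat, 2 * (1 + rho / k) <= N%:R.
  exists (Num.bound (2 * (1 + rho / k))); apply/ltW/archi_boundP.
  by rewrite mulr_ge0// addr_ge0// divr_ge0 ?(ltW k0)// addr_ge0// cabs_ge0.
have [K K0 HK] := fin (enum_fset (square N)).
exists (K + 2 / k); first by rewrite addr_gt0// divr_gt0.
have near1 : \forall z \near z0, cabs (z - z0) < 1 by apply/nbhs_cabs; exists 1.
apply: filterS2 HK near1 => z H z1 n n0.
have c0 := cabs_ge0 (z + tau n).
have k2 : 0 <= 2 / k by rewrite divr_ge0// ltW.
have [nN|nN] := boolP (n \in square N); first by have := H n nN n0; nra.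
have nuN : N%:R <= nu n.
  rewrite /nu ler_nat; move: nN; rewrite in_square; case: n {n0 c0} => ? ? /=; lia.
suff : nu n <= 2 / k * cabs (z + tau n) by nra.
have zrho : cabs z <= rho.
  by have := cabsD (z - z0) z0; rewrite subrK /rho; lra.
have tn : k * (nu n - 1) - rho <= cabs (z + tau n).
  by have := kP n; have := cabs_ge (tau n) z; rewrite [tau n + z]addrC; lra.
rewrite mulrAC ler_pdivlMr//.
have : k * (2 * (1 + rho / k)) <= k * nu n.
  by rewrite ler_wpM2l ?(ltW k0)//; exact: le_trans HN nuN.
have -> : k * (2 * (1 + rho / k)) = 2 * (k + rho) by field; exact: lt0r_neq0.
nra.
Qed.

Lemma nu_le_at z : regular z -> exists2 K : R, 0 < K &
  forall n, n != (0, 0) -> nu n <= K * cabs (z + tau n).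
Proof. by move=> /nu_le[K K0 /nbhs_singleton H]; exists K. Qed.

Lemma inv_le_nu (K : R) z n : 0 < K -> nu n <= K * cabs (z + tau n) ->
  cabs (z + tau n)^-1 <= K / nu n.
Proof.
move=> K0 H; have n0 := @nu_gt0 R n.
have c0 : 0 < cabs (z + tau n) by have := cabs_ge0 (z + tau n); nra.
by rewrite cabsV ler_pdivlMr// mulrC ler_pdivrMr.
Qed.

Lemma regular0 : regular 0.
Proof.
move=> n; apply: contraNneq; rewrite add0r => tn.
have [k k0 /(_ n)] := tau_coercive; rewrite tn cabs0.
rewrite pmulr_rle0// subr_le0 /nu (ler_nat _ _ 1%N); case: n {tn} => n1 n2 /= ?.
by apply/eqP; congr (_, _); lia.
Qed.

Lemma notin_lattice z : ~ lattice w1 w2 z -> forall n, z + tau n != 0.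
Proof.
move=> zL n; apply: contra_notN zL; rewrite addr_eq0 => /eqP ->.
by exists (- n.1), (- n.2); exact: esym (tauN n).
Qed.

Lemma notin_lattice_regular z : ~ lattice w1 w2 z -> regular z.
Proof. by move=> /notin_lattice zL n _. Qed.

Definition chi n : Cplx R := (-1) ^ n.1.

Lemma chi_next n : chi (n.1 + 1, n.2) = - chi n.
Proof. by rewrite /chi/= expfzDr ?oppr_eq0 ?oner_eq0// expr1z mulrN1. Qed.

Lemma chi_prev n : chi (n.1 - 1, n.2) = - chi n.
Proof. by rewrite /chi/= expfzDr ?oppr_eq0 ?oner_eq0// exprN1 invrN1 mulrN1. Qed.

Lemma chiN n : chi (- n.1, - n.2) = chi n.
Proof. by rewrite /chi/= -exprz_inv invrN1. Qed.

Lemma chiD n k : chi (n.1 + k.1, n.2 + k.2) = chi n * chi k.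
Proof. by rewrite /chi/= expfzDr ?oppr_eq0 ?oner_eq0. Qed.

Lemma chi_sqr n : chi n * chi n = 1.
Proof. by rewrite /chi -expfzMl mulrNN mul1r exp1rz. Qed.

Lemma cabs_chi n : cabs (chi n) = 1.
Proof.
have /eqP : cabs (chi n) ^+ 2 = 1 by rewrite expr2 -cabsM chi_sqr cabs1.
by rewrite sqrf_eq1 => /orP[/eqP//|/eqP c1]; have := cabs_ge0 (chi n); lra.
Qed.

(* The Euler transform of 1 / y in the direction w1: replacing the terms of
   sum chi n / (z + tau n) by chi n * psi (z + tau n) makes the sum absolutely
   convergent. *)
Definition psi y : Cplx R := (2 / y - 1 / (y + w1) - 1 / (y - w1)) / 4.

Lemma psiN y : psi (- y) = - psi y.
Proof.
rewrite /psi (_ : - y + w1 = - (y - w1)); last by ring.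
by rewrite -opprD !invrN; ring.
Qed.

Lemma psiE y : y != 0 -> y + w1 != 0 -> y - w1 != 0 ->
  psi y = - (w1 ^+ 2 / 2) * (y^-1 * (y + w1)^-1 * (y - w1)^-1).
Proof. by move=> y0 y1 y2; rewrite /psi; field; rewrite y0 y1 y2. Qed.

Lemma nu_next n : nu n <= 2 * nu (n.1 + 1, n.2) :> R.
Proof. by rewrite -natrM ler_nat; case: n => n1 n2 /=; lia. Qed.

Lemma nu_prev n : nu n <= 2 * nu (n.1 - 1, n.2) :> R.
Proof. by rewrite -natrM ler_nat; case: n => n1 n2 /=; lia. Qed.

(** The indices n for which one of the three denominators of [psi (z + tau n)] may vanish although z
    is regular. *)
Definition poles : {fset int * int} := [fset (0, 0); (1, 0); (-1, 0)]%fset.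

Lemma notin_poles n : n \notin poles ->
  [/\ n != (0, 0), (n.1 + 1, n.2) != (0, 0) & (n.1 - 1, n.2) != (0, 0)].
Proof.
case: n => n1 n2; rewrite !inE !negb_or !xpair_eqE /= => H; split; lia.
Qed.

(** The second difference of 1/y is a product of three fractions, each of order 1/nu; passing from a
    neighbouring index back to n costs a factor 2 twice. *)
Lemma psi_le z0 : regular z0 -> exists2 K : R, 0 <= K &
  \forall z \near z0, forall n, n \notin poles ->
    cabs (psi (z + tau n)) <= K * nu n ^- 3.
Proof.
move=> /nu_le[K K0 near_K].
exists (2 * cabs w1 ^+ 2 * K ^+ 3).
  by rewrite mulr_ge0 ?exprn_ge0 ?mulr_ge0 ?cabs_ge0//; lra.
apply: filterS near_K => z H n /notin_poles[n0 np nm].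
have pos k : k != (0, 0) -> z + tau k != 0.
  by move=> /H; rewrite -cabs_gt0; have := @nu_gt0 R k; nra.
have zp : z + tau n + w1 = z + tau (n.1 + 1, n.2) by rewrite tau_next -addrA.
have zm : z + tau n - w1 = z + tau (n.1 - 1, n.2) by rewrite tau_prev -addrA.
rewrite psiE ?zp ?zm ?pos// !cabsM cabsN cabsM cabsX cabsV cabs_nat.
have h0 := inv_le_nu K0 (H _ n0).
have two k : nu n <= 2 * nu k :> R -> K / nu k <= 2 * K / nu n.
  move=> nk; rewrite ler_pdivrMr ?nu_gt0// mulrAC ler_pdivlMr ?nu_gt0//; nra.
have h1 := le_trans (inv_le_nu K0 (H _ np)) (two _ (nu_next n)).
have h2 := le_trans (inv_le_nu K0 (H _ nm)) (two _ (nu_prev n)).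
have -> : 2 * cabs w1 ^+ 2 * K ^+ 3 * nu n ^- 3 =
    cabs w1 ^+ 2 / 2 * (K / nu n * (2 * K / nu n) * (2 * K / nu n)).
  by field; rewrite lt0r_neq0 ?nu_gt0.
rewrite ler_wpM2l ?mulr_ge0 ?invr_ge0 ?cabs_ge0//.
by apply: ler_pM; rewrite ?mulr_ge0 ?cabs_ge0//; apply: ler_pM; rewrite ?cabs_ge0.
Qed.

Definition inv_sn_sum z : Cplx R := tsum (fun n => chi n * psi (z + tau n)).
Local Notation g := inv_sn_sum.

Lemma psi_bounded z : regular z -> bounded_sums (fun n => cabs (chi n * psi (z + tau n))).
Proof.
move=> /psi_le[K K0 /nbhs_singleton H].
apply: (@bounded_sums_le _ _ (fun n => K * nu n ^- 3) _ poles).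
- by move=> n; rewrite mulr_ge0// invr_ge0 exprn_ge0// ltW// nu_gt0.
- exact: nu3_bounded.
- by move=> n /H; rewrite cabsM cabs_chi mul1r.
Qed.

Lemma gP z : regular z -> has_sum (fun n => chi n * psi (z + tau n)) (g z).
Proof. by move=> /psi_bounded; exact: tsumP. Qed.

Lemma gN z : regular z -> g (- z) = - g z.
Proof.
move=> z_reg; apply: tsumE.
have := @has_sumZ _ _ (-1) _ _ (gP z_reg); rewrite mulN1r.
move=> /(has_sum_reindex (phi := fun n => (- n.1, - n.2)) (psi := fun n => (- n.1, - n.2))).
have NK : cancel (fun n : int * int => (- n.1, - n.2)) (fun n => (- n.1, - n.2)).
  by move=> [n1 n2] /=; rewrite !opprK.
move=> /(_ NK NK); congr has_sum; apply/funext => n.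
by rewrite chiN tauN mulN1r -mulrN -psiN opprB addrC.
Qed.

Lemma g0 : g 0 = 0.
Proof.
have := gN regular0; rewrite oppr0 => /eqP; rewrite -addr_eq0 -mulr2n mulrn_eq0 /=.
by move=> /eqP.
Qed.

End LatticeFunction.

(** * Continuity of g, its pole at 0, and rectangular partial sums *)

Section LatticeFunctionLimits.
Context {R : realType} (w1 w2 : Cplx R).
Hypothesis hw : R_independent w1 w2.
Implicit Types (n : int * int) (x y z a : Cplx R).
Local Notation nu := (@nu R).
Local Notation tau := (lattice_pt w1 w2).
Local Notation regular := (regular w1 w2).
Local Notation chi := (@chi R).
Local Notation psi := (psi w1).
Local Notation g := (inv_sn_sum w1 w2).

Lemma regular_near z0 : regular z0 -> \forall z \near z0, regular z.
Proof.
move=> /(nu_le hw)[K K0]; apply: filterS => z H n n0.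
by have := H n n0; rewrite -cabs_gt0; have := @nu_gt0 R n; nra.
Qed.

Lemma cvg_inv_shift (F : set_system (Cplx R)) {FF : Filter F} (c z0 : Cplx R) :
  z @[z --> F] --> z0 -> z0 + c != 0 -> (z + c)^-1 @[z --> F] --> (z0 + c)^-1.
Proof.
by move=> Fz zc; exact (cplx_cvgV zc (cplx_cvgD Fz (cplx_cvg_cst c))).
Qed.

Lemma g_cvg z0 : ~ lattice w1 w2 z0 -> g z @[z --> z0] --> g z0.
Proof.
move=> z0L; have z0_reg := notin_lattice_regular z0L.
have z0t := notin_lattice z0L.
have [K K0 near_K] := psi_le hw z0_reg.
apply: (@tannery _ _ _ _ (nbhs_pfilter z0) (fun z n => chi n * psi (z + tau n))
  (fun n => chi n * psi (z0 + tau n)) (fun n => K * nu n ^- 3) poles).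
- by move=> n; rewrite mulr_ge0// invr_ge0 exprn_ge0// ltW// nu_gt0.
- exact: nu3_bounded.
- by apply: filterS near_K => z H n /H; rewrite cabsM cabs_chi mul1r.
- move=> n; apply: cplx_cvgM; first exact: cplx_cvg_cst.
  have zid : z @[z --> z0] --> z0 by exact: cvg_id.
  apply: cplx_cvgM; last exact: cplx_cvg_cst.
  apply: cplx_cvgB; first apply: cplx_cvgB.
  + apply: cplx_cvgM; first exact: cplx_cvg_cst.
    exact: (cvg_inv_shift zid (z0t n)).
  + apply: cplx_cvgM; first exact: cplx_cvg_cst.
    have nz : z0 + tau n + w1 != 0 by rewrite -addrA -tau_next z0t.
    exact: (cplx_cvgV nz (cplx_cvgD (cplx_cvgD zid (cplx_cvg_cst (tau n)))
      (cplx_cvg_cst w1))).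
  + apply: cplx_cvgM; first exact: cplx_cvg_cst.
    have nz : z0 + tau n - w1 != 0 by rewrite -addrA -tau_prev z0t.
    exact: (cplx_cvgV nz (cplx_cvgB (cplx_cvgD zid (cplx_cvg_cst (tau n)))
      (cplx_cvg_cst w1))).
- by apply: filterS (regular_near z0_reg) => z; exact: gP.
- exact: gP.
Qed.

Lemma pole_cvg (c : Cplx R) : z * (z + c)^-1 @[z --> 0^'] --> ((c == 0)%:R : Cplx R).
Proof.
have [->|c0] := eqVneq c 0.
  apply: (@cvg_trans _ ((1 : Cplx R) @[z --> (0 : Cplx R)^'])); last exact: cplx_cvg_cst.
  apply: near_eq_cvg; near=> z; rewrite addr0 divff//.
  by near: z; exact: nbhs_dnbhs_neq.
rewrite -[0%:R](mul0r (0 + c)^-1).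
have id0 : z @[z --> 0^'] --> (0 : Cplx R) by move=> A A0; exact: nbhs_dnbhs.
have nz : 0 + c != 0 by rewrite add0r.
exact: (cplx_cvgM id0 (cvg_inv_shift id0 nz)).
Unshelve. all: by end_near.
Qed.

(** The residue of g at 0, term by term: 1/2 from (0, 0), and 1/4 from each of (1, 0) and (-1, 0),
    where the sign of [chi] cancels the minus sign in [psi]. *)
Lemma has_sum_pole : has_sum (fun n => chi n *
   ((2 * (tau n == 0)%:R - (tau (n.1 + 1, n.2) == 0)%:R
     - (tau (n.1 - 1, n.2) == 0)%:R) / 4)) (1 : Cplx R).
Proof.
have t0 n : (tau n == 0) = (n == (0, 0)).
  apply/idP/idP => [|/eqP->]; last by rewrite tau0.
  by apply: contraTT => /(regular0 hw); rewrite add0r.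
rewrite [X in has_sum _ X](_ : 1 = \sum_(n <- poles) (chi n *
   ((2 * (tau n == 0)%:R - (tau (n.1 + 1, n.2) == 0)%:R
     - (tau (n.1 - 1, n.2) == 0)%:R) / 4))).
  apply: has_sum_fin => n /notin_poles[n0 n1 n2].
  by rewrite !t0 (negPf n0) (negPf n1) (negPf n2); ring.
rewrite /poles -fsetUA big_fsetU1/=; last by rewrite !inE.
rewrite big_fsetU1/=; last by rewrite !inE.
rewrite big_seq_fset1 !t0 /chi/= expr0z expr1z exprN1 invrN1.
by field.
Qed.

Lemma g_pole : z * g z @[z --> 0^'] --> (1 : Cplx R).
Proof.
have [K K0 near_K] := psi_le hw (regular0 hw).
apply: (@tannery _ _ _ _ (Proper_dnbhs_numFieldType 0) (fun z n => z * (chi n * psi (z + tau n))) _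
  (fun n => K * nu n ^- 3) poles (fun z => z * g z) 1 _ _ _ _ _ has_sum_pole).
- by move=> n; rewrite mulr_ge0// invr_ge0 exprn_ge0// ltW// nu_gt0.
- exact: nu3_bounded.
- have near1 : \forall z \near (0 : Cplx R), cabs z < 1.
    by apply/nbhs_cabs; exists 1 => // z; rewrite subr0.
  apply: nbhs_dnbhs; apply: filterS2 near_K near1 => z H z1 n nP.
  rewrite cabsM (cabsM (chi n)) cabs_chi mul1r; apply: le_trans (H n nP).
  by rewrite ler_piMl ?cabs_ge0// ltW.
- move=> n; rewrite (_ : (fun z => _) = (fun z => chi n *
    ((2 * (z * (z + tau n)^-1) - z * (z + tau (n.1 + 1, n.2))^-1
      - z * (z + tau (n.1 - 1, n.2))^-1) / 4))); last first.
    by apply/funext => z; rewrite tau_next tau_prev !addrA /psi; ring.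
  have p0 := @pole_cvg (tau n); have p1 := @pole_cvg (tau (n.1 + 1, n.2)).
  have p2 := @pole_cvg (tau (n.1 - 1, n.2)).
  exact: (cplx_cvgM (cplx_cvg_cst (chi n)) (cplx_cvgM (cplx_cvgB
    (cplx_cvgB (cplx_cvgM (cplx_cvg_cst 2) p0) p1) p2) (cplx_cvg_cst 4^-1))).
- apply: nbhs_dnbhs; apply: filterS (regular_near (regular0 hw)) => z z_reg.
  by apply: has_sumZ; exact: gP.
Qed.

Lemma sum_telescope2 (V : comNzRingType) (d : int -> V) (p N : nat) :
  \sum_(i < N.+1) (2 * d (i%:Z - p%:Z) - d (i%:Z - p%:Z + 1) - d (i%:Z - p%:Z - 1)) =
  d (- p%:Z) - d (- p%:Z - 1) + d (N%:Z - p%:Z) - d (N%:Z - p%:Z + 1).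
Proof.
elim: N => [|N IH]; first by rewrite big_ord1 /= !sub0r; ring.
rewrite big_ord_recr IH/=.
have -> : N.+1%:Z - p%:Z = N%:Z - p%:Z + 1 by lia.
by rewrite addrK; ring.
Qed.

(** Averaging changes the alternating terms by second differences in n1, whose sum over a rectangle
    telescopes to four boundary columns. *)
Lemma rect_sum_g x : ~ lattice w1 w2 x ->
  rect_sum (fun n1 n2 : int => (-1) ^ n1 *
    ((x + period w1 w2 n1 n2)^-1 - (period w1 w2 n1 n2)^-1)) p
    @[p --> rect_filter] --> g x.
Proof.
move=> xL; have x_reg := notin_lattice_regular xL.
pose F n : Cplx R := chi n * ((x + tau n)^-1 - (tau n)^-1).
have [K1 K10 HK1] := nu_le_at hw x_reg.
have [K2 K20 HK2] := nu_le_at hw (regular0 hw).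
pose K := cabs x * K1 * K2.
have K0 : 0 <= K by rewrite !mulr_ge0 ?cabs_ge0// ltW.
have F_le n : n != (0, 0) -> cabs (F n) <= K * nu n ^- 2.
  move=> n0; have h1 := inv_le_nu K10 (HK1 n n0).
  have := inv_le_nu K20 (HK2 n n0); rewrite add0r => h2.
  have t0 : tau n != 0 by have := regular0 hw n0; rewrite add0r.
  have xt0 := x_reg n n0.
  rewrite /F cabsM cabs_chi mul1r.
  have -> : (x + tau n)^-1 - (tau n)^-1 = - x * ((x + tau n)^-1 * (tau n)^-1).
    by field; rewrite t0 xt0.
  rewrite !cabsM cabsN /K.
  have -> : cabs x * K1 * K2 * nu n ^- 2 = cabs x * (K1 / nu n * (K2 / nu n)).
    by field; rewrite lt0r_neq0// nu_gt0.
  by rewrite ler_wpM2l ?cabs_ge0// ler_pM ?cabs_ge0.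
(* The subtracted 1/tau sums to [g 0], which is 0 by oddness. *)
have sumg : has_sum (fun n => chi n * psi (x + tau n) - chi n * psi (0 + tau n)) (g x).
  by have := has_sumB (gP hw x_reg) (gP hw (regular0 hw)); rewrite (g0 hw) subr0.
have col_le (n1 : int) q : n1 != 0 ->
    cabs (\sum_(j < (q.1 + q.2).+1) F (n1, j%:Z - q.1%:Z)) <=
    K * (4 / (1 + `|n1|%N)%:R).
  move=> n10; apply: le_trans (cabs_sum _ _ _) _.
  apply: le_trans (_ : _ <= K * \sum_(j < (q.1 + q.2).+1) nu (n1, j%:Z - q.1%:Z) ^- 2) _.
    by rewrite mulr_sumr; apply: ler_sum => j _; rewrite F_le// xpair_eqE (negPf n10).
  by rewrite ler_wpM2l// column_sum_le.
pose col (q : nat * nat) (n1 : int) : Cplx R :=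
  \sum_(j < (q.1 + q.2).+1) F (n1, j%:Z - q.1%:Z).
have rectE p : rect_sum (fun n1 n2 : int => (-1) ^ n1 *
    ((x + period w1 w2 n1 n2)^-1 - (period w1 w2 n1 n2)^-1)) p =
  \sum_(n <- rect p) (chi n * psi (x + tau n) - chi n * psi (0 + tau n)) +
  (col p.2 (- p.1.1%:Z) - col p.2 (- p.1.1%:Z - 1) +
   col p.2 p.1.2%:Z - col p.2 (p.1.2%:Z + 1)) / 4.
  have -> : p.1.2%:Z = (p.1.1 + p.1.2)%N%:Z - p.1.1%:Z by lia.
  rewrite -(sum_telescope2 (col p.2)) big_rect mulr_suml -big_split/=.
  apply: eq_bigr => i _; rewrite /col !mulr_sumr -!sumrB mulr_suml -big_split/=.
  apply: eq_bigr => j _; set n := (_, _).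
  rewrite -/(tau n) (_ : (i%:Z - _ + 1, _) = (n.1 + 1, n.2))//.
  rewrite (_ : (i%:Z - _ - 1, _) = (n.1 - 1, n.2))//.
  rewrite /F chi_next chi_prev -/(chi n) tau_next tau_prev.
  rewrite (addrA x _ w1) (addrA x _ (- w1)) /psi add0r !mul1r.
  move: (chi n) (x + tau n)^-1 (x + tau n + w1)^-1 (x + tau n - w1)^-1.
  move: (tau n)^-1 (tau n + w1)^-1 (tau n - w1)^-1 => ? ? ? ? ? ? ?.
  by field.
apply/cvg_cabsP => e e0; have e2 : 0 < e / 2 by lra.
have main : \forall p \near rect_filter, cabs (\sum_(n <- rect p)
    (chi n * psi (x + tau n) - chi n * psi (0 + tau n)) - g x) < e / 2.
  exact: (cvg_cabsP _ _).1 (cvg_comp _ _ rect_cvg sumg) _ e2.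
(* Beyond N a column is at most 4 K / (1 + N) < e / 2, so four of them divided by 4 stay below e /
   2. *)
have [N HN] : exists N : nat, 8 * K / e < N%:R.
  exists (Num.bound (8 * K / e)); apply: archi_boundP.
  by rewrite divr_ge0 ?(ltW e0)// mulr_ge0.
apply: filterS2 main (rect_filter_ge N.+1) => p /= near_sum [Np1 Np2 _ _].
rewrite rectE addrAC.
have colN (n1 : int) : (N < `|n1|)%N -> cabs (col p.2 n1) < e / 2.
  move=> Nn1; apply: le_lt_trans (col_le _ _ _) _; first by lia.
  have NN : N%:R <= (1 + `|n1|%N)%:R :> R by rewrite ler_nat; lia.
  have N0 : 0 < (1 + `|n1|%N)%:R :> R by rewrite ltr0n.
  rewrite mulrA ltr_pdivrMr//.
  by move: HN; rewrite ltr_pdivrMr//; nra.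
apply: le_lt_trans (cabsD _ _) _.
rewrite [X in _ + X]cabsM cabsV cabs_nat.
have [/colN c1 /colN c2 /colN c3 /colN c4] : [/\ (N < absz (- p.1.1%:Z)%R)%N,
    (N < absz (- p.1.1%:Z - 1)%R)%N, (N < absz p.1.2%:Z)%N &
    (N < absz (p.1.2%:Z + 1)%R)%N].
  by move: p.1.1 p.1.2 Np1 Np2; clear => p1 p2 h1 h2; split; lia.
have := cabsB (col p.2 (- p.1.1%:Z) - col p.2 (- p.1.1%:Z - 1) + col p.2 p.1.2)
  (col p.2 (p.1.2%:Z + 1)).
have := cabsD (col p.2 (- p.1.1%:Z) - col p.2 (- p.1.1%:Z - 1)) (col p.2 p.1.2).
have := cabsB (col p.2 (- p.1.1%:Z)) (col p.2 (- p.1.1%:Z - 1)).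
lra.
Qed.

End LatticeFunctionLimits.

(** * Partial sums of g with simple fractions *)

Section ProductFormula.
Context {R : realType} (w1 w2 : Cplx R).
Hypothesis hw : R_independent w1 w2.
Implicit Types (n k : int * int) (x y z a : Cplx R).
Local Notation nu := (@nu R).
Local Notation tau := (lattice_pt w1 w2).
Local Notation regular := (regular w1 w2).
Local Notation chi := (@chi R).
Local Notation psi := (psi w1).
Local Notation g := (inv_sn_sum w1 w2).

(* The partial sums of g over square N are sums of chi n / (z + tau n) with
   these weights. *)
Definition euler_weight N n : Cplx R :=
  (2 * (n \in square N)%:R + ((n.1 - 1, n.2) \in square N)%:R
   + ((n.1 + 1, n.2) \in square N)%:R) / 4.

Lemma sum_euler_weight N (F : int * int -> Cplx R) :
  \sum_(n <- square N.+1) euler_weight N n * F n =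
  \sum_(n <- square N) (2 * F n + F (n.1 + 1, n.2) + F (n.1 - 1, n.2)) / 4.
Proof.
have shift h h' := @fsum_shift R _ (square N) (square N.+1) h h' F.
have s0 := shift id id (fun _ => erefl) (fun _ => erefl).
have s1 := shift (fun n => (n.1 + 1, n.2)) (fun n => (n.1 - 1, n.2)).
have s2 := shift (fun n => (n.1 - 1, n.2)) (fun n => (n.1 + 1, n.2)).
rewrite -mulr_suml !big_split/= -mulr_sumr -s0; last first.
  by move=> n; rewrite !in_square; lia.
rewrite -s1; first last.
- by case=> n1 n2; rewrite !in_square/=; clear; lia.
- by case=> n1 n2 /=; rewrite subrK.
- by case=> n1 n2 /=; rewrite addrK.
rewrite -s2; first last.
- by case=> n1 n2; rewrite !in_square/=; clear; lia.
- by case=> n1 n2 /=; rewrite addrK.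
- by case=> n1 n2 /=; rewrite subrK.
rewrite mulr_sumr -!big_split/= mulr_suml; apply: eq_bigr => n _.
by rewrite /euler_weight; ring.
Qed.

(** With the average moved from the terms to the weights, the summands are simple fractions, ready
    for partial fractions. *)
Lemma sum_euler_weight_inv N y :
  \sum_(n <- square N.+1) euler_weight N n * (chi n / (y + tau n)) =
  \sum_(n <- square N) chi n * psi (y + tau n).
Proof.
rewrite sum_euler_weight; apply: eq_bigr => n _.
rewrite chi_next chi_prev tau_next tau_prev /psi !mul1r.
rewrite (addrA y _ w1) (addrA y _ (- w1)).
move: (chi n) (y + tau n)^-1 (y + tau n + w1)^-1 (y + tau n - w1)^-1 => ? ? ? ?.
by field.
Qed.

Lemma square_cvg : square N @[N --> \oo] --> totally.
Proof.
apply: cvg_totally => n; exists (`|n.1| + `|n.2|)%N => // N /= nN.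
by rewrite in_square; case: n nN => n1 n2 /=; lia.
Qed.

Lemma partial_g_cvg z : regular z ->
  \sum_(n <- square N.+1) euler_weight N n * (chi n / (z + tau n)) @[N --> \oo]
    --> g z.
Proof.
move=> z_reg; have := cvg_comp _ _ square_cvg (gP hw z_reg).
apply: cvg_trans; apply: near_eq_cvg; apply: nearW => N /=.
by rewrite sum_euler_weight_inv.
Qed.

Lemma euler_weightN N n : euler_weight N (- n.1, - n.2) = euler_weight N n.
Proof.
have e1 : - n.1 - 1 = - (n.1 + 1) by ring.
have e2 : - n.1 + 1 = - (n.1 - 1) by ring.
by rewrite /euler_weight !in_square/= e1 e2 !abszN; congr (_ / 4); ring.
Qed.

Lemma euler_weight_le N n : cabs (euler_weight N n) <= 1.
Proof.
rewrite /euler_weight -natrM -!natrD cabsM cabsV !cabs_nat ler_pdivrMr// mul1r.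
by rewrite ler_nat; do 3! case: (_ \in _).
Qed.

Lemma euler_weight_near N n : (`|n.1| + `|n.2| < N)%N -> euler_weight N n = 1.
Proof.
rewrite /euler_weight !in_square; case: n => n1 n2 /= nN.
rewrite (_ : _ && _); last by lia.
rewrite (_ : _ && _); last by lia.
rewrite (_ : _ && _); last by lia.
by rewrite /=; field.
Qed.

End ProductFormula.

(** * Products of partial sums by partial fractions *)

Section ProductLimit.
Context {R : realType} (w1 w2 : Cplx R).
Hypothesis hw : R_independent w1 w2.
Implicit Types (n k l : int * int) (x y z a : Cplx R).
Local Notation nu := (@nu R).
Local Notation tau := (lattice_pt w1 w2).
Local Notation regular := (regular w1 w2).
Local Notation chi := (@chi R).
Local Notation psi := (psi w1).
Local Notation g := (inv_sn_sum w1 w2).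
Local Notation euler_weight := (@euler_weight R).

Lemma sum_square_opp N (F : int * int -> Cplx R) :
  \sum_(n <- square N) F (- n.1, - n.2) = \sum_(n <- square N) F n.
Proof.
have NK : cancel (fun n => (- n.1, - n.2)) (fun n : int * int => (- n.1, - n.2)).
  by move=> [n1 n2] /=; rewrite !opprK.
have NS : {in square N, forall n, (- n.1, - n.2) \in square N}.
  by move=> n; rewrite !in_square /= !abszN.
rewrite -(fsum_shift F NK NK NS); apply: eq_big_seq => n /NS ->.
by rewrite mul1r.
Qed.

(** Up to its own weight, the coefficient of 1/(z + tau n) in the product of the partial sums at z
    and z + a. A pair with equal denominators contributes 1/0 = 0 here and is accounted for
    separately. *)
Definition euler_conv a N n : Cplx R :=
  \sum_(k <- square N.+1) euler_weight N k *
    (chi (k.1 - n.1, k.2 - n.2) / (a + tau (k.1 - n.1, k.2 - n.2))).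

Lemma tauB n k : tau (k.1 - n.1, k.2 - n.2) = tau k - tau n.
Proof. by rewrite -tauN -tauD. Qed.

Lemma chiB n k : chi (k.1 - n.1, k.2 - n.2) = chi k * chi n.
Proof. by rewrite -(chiN n) -chiD. Qed.

(** This is a partial sum of the series of [g a] over a translated square: hence its limit for fixed
    n and its bound uniform in N and n. *)
Lemma euler_convE a N n : euler_conv a N n =
  \sum_(k <- square N) chi (k.1 - n.1, k.2 - n.2) * psi (a + tau (k.1 - n.1, k.2 - n.2)).
Proof.
rewrite /euler_conv; transitivity (chi n * \sum_(k <- square N.+1)
    euler_weight N k * (chi k / ((a - tau n) + tau k))).
  rewrite mulr_sumr; apply: eq_bigr => k _; rewrite chiB tauB.
  by rewrite (_ : a + (tau k - tau n) = a - tau n + tau k); ring.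
rewrite (sum_euler_weight_inv w1 w2) mulr_sumr; apply: eq_bigr => k _.
by rewrite chiB tauB (_ : a + (tau k - tau n) = a - tau n + tau k); ring.
Qed.

(** With 1/0 = 0 the first term vanishes when [x = y], so that one identity covers equal and
    distinct denominators. *)
Lemma inv_mul_split (x y : Cplx R) : x != 0 -> y != 0 ->
  x^-1 * y^-1 = (x^-1 - y^-1) / (y - x) + (x == y)%:R * x ^- 2.
Proof.
move=> x0 y0; have [->|xy] := eqVneq x y.
  by rewrite subrr mul0r mul1r add0r -invfM expr2.
have yx : y - x != 0 by rewrite subr_eq0 eq_sym.
by rewrite mul0r addr0; field; rewrite x0 y0 yx.
Qed.

Lemma finite_product N z a : (forall n, z + tau n != 0) ->
    (forall n, z + a + tau n != 0) ->
  (\sum_(n <- square N.+1) euler_weight N n * (chi n / (z + tau n))) *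
  (\sum_(n <- square N.+1) euler_weight N n * (chi n / (z + a + tau n))) =
  \sum_(n <- square N.+1) euler_weight N n * euler_conv a N n *
    ((z + tau n)^-1 - (z + a - tau n)^-1) +
  \sum_(k <- square N.+1) \sum_(l <- square N.+1)
    (z + tau k == z + a + tau l)%:R *
    (euler_weight N k * euler_weight N l * (chi k * chi l) * (z + tau k) ^- 2).
Proof.
move=> z0 za0; pose E k l := euler_weight N k * euler_weight N l * (chi k * chi l).
transitivity (\sum_(k <- square N.+1) \sum_(l <- square N.+1)
  (E k l / (a + tau l - tau k) * (z + tau k)^-1
   - E k l / (a + tau l - tau k) * (z + a + tau l)^-1
   + (z + tau k == z + a + tau l)%:R * (E k l * (z + tau k) ^- 2))).
  rewrite big_distrlr/=; apply: eq_bigr => k _; apply: eq_bigr => l _.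
  have := inv_mul_split (z0 k) (za0 l).
  rewrite (_ : z + a + tau l - (z + tau k) = a + tau l - tau k); last by ring.
  move: (z + tau k)^-1 (z + a + tau l)^-1 (_ == _)%:R ((z + tau k) ^- 2) => p q r s.
  rewrite /E => H; transitivity (euler_weight N k * euler_weight N l * (chi k * chi l) * (p * q)).
    by ring.
  by rewrite H; ring.
under eq_bigr do rewrite big_split sumrB /=.
rewrite big_split sumrB /=; congr (_ + _).
under [RHS]eq_bigr do rewrite mulrBr; rewrite sumrB; congr (_ - _).
  apply: eq_bigr => k _; rewrite /euler_conv mulr_sumr mulr_suml.
  by apply: eq_bigr => l _; rewrite chiB tauB (addrA a (tau l)) /E; ring.
(* Reflecting both indices gives the fractions in z + a the same coefficients [euler_conv], with
   -tau in place of tau. *)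
rewrite exchange_big/= -sum_square_opp; apply: eq_bigr => l _.
rewrite -sum_square_opp /euler_conv mulr_sumr mulr_suml; apply: eq_bigr => k _.
rewrite /E !chiN !euler_weightN chiB tauB !tauN opprK.
rewrite (_ : a - tau l + tau k = a + (tau k - tau l)); last by ring.
by ring.
Qed.

Lemma inv_sub_shift (x y c : Cplx R) : x + c != 0 -> y + c != 0 ->
  (x + c)^-1 - (y + c)^-1 = (y - x) * ((x + c)^-1 * (y + c)^-1).
Proof. by move=> xc yc; field; rewrite xc yc. Qed.

(** Each difference is of order nu^-2; their leading terms cancel because the two displacements are
    opposite. *)
Lemma inv_diff4_le x x' y y' : regular x -> regular x' -> regular y -> regular y' ->
  x' - x = y - y' -> exists K : R, forall n, n != (0, 0) ->
  cabs ((x + tau n)^-1 - (x' + tau n)^-1 + ((y + tau n)^-1 - (y' + tau n)^-1))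
    <= K * nu n ^- 3.
Proof.
move=> rx rx' ry ry' xy.
have [K1 K10 H1] := nu_le_at hw rx; have [K2 K20 H2] := nu_le_at hw rx'.
have [K3 K30 H3] := nu_le_at hw ry; have [K4 K40 H4] := nu_le_at hw ry'.
exists (cabs (x' - x) * (cabs (y' - x') * (K1 * K2 * K4) + cabs (y - x) * (K1 * K3 * K4))).
move=> n n0.
have A0 := rx n n0; have B0 := rx' n n0; have C0 := ry n n0; have D0 := ry' n n0.
have h1 := inv_le_nu K10 (H1 n n0); have h2 := inv_le_nu K20 (H2 n n0).
have h3 := inv_le_nu K30 (H3 n n0); have h4 := inv_le_nu K40 (H4 n n0).
have ab := inv_sub_shift A0 B0; have cd := inv_sub_shift C0 D0.
have bd := inv_sub_shift B0 D0; have ac := inv_sub_shift A0 C0.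
have -> : (x + tau n)^-1 - (x' + tau n)^-1 + ((y + tau n)^-1 - (y' + tau n)^-1) =
  (x' - x) * ((y' - x') * ((x + tau n)^-1 * (x' + tau n)^-1 * (y' + tau n)^-1) +
              (y - x) * ((x + tau n)^-1 * (y + tau n)^-1 * (y' + tau n)^-1)).
  rewrite ab cd; move: (x + tau n)^-1 (x' + tau n)^-1 ac bd => p q.
  move: (y + tau n)^-1 (y' + tau n)^-1 => r s ac bd.
  rewrite (_ : y' - y = - (x' - x)); last by rewrite xy; ring.
  transitivity ((x' - x) * (p * (q - s) + s * (p - r))); first by ring.
  by rewrite ac bd; ring.
rewrite cabsM -[leRHS]mulrA ler_wpM2l ?cabs_ge0//; apply: le_trans (cabsD _ _) _.
rewrite !(cabsM (_ - _)) !cabsM.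
have -> : (cabs (y' - x') * (K1 * K2 * K4) + cabs (y - x) * (K1 * K3 * K4)) * nu n ^- 3
  = cabs (y' - x') * (K1 / nu n * (K2 / nu n) * (K4 / nu n))
    + cabs (y - x) * (K1 / nu n * (K3 / nu n) * (K4 / nu n)).
  by field; rewrite lt0r_neq0// nu_gt0.
by apply: lerD; rewrite ler_wpM2l ?cabs_ge0//; apply: ler_pM => //;
  rewrite ?mulr_ge0 ?cabs_ge0//; apply: ler_pM; rewrite ?cabs_ge0.
Qed.

Lemma inv2_diff_le x y : regular x -> regular y -> exists K : R,
  forall n, n != (0, 0) ->
  cabs ((x + tau n) ^- 2 - (y + tau n) ^- 2) <= K * nu n ^- 3.
Proof.
move=> rx ry; have [K1 K10 H1] := nu_le_at hw rx; have [K2 K20 H2] := nu_le_at hw ry.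
exists (cabs (y - x) * (K1 * K1 * K2 + K1 * K2 * K2)) => n n0.
have A0 := rx n n0; have B0 := ry n n0.
have h1 := inv_le_nu K10 (H1 n n0); have h2 := inv_le_nu K20 (H2 n n0).
have -> : (x + tau n) ^- 2 - (y + tau n) ^- 2 =
  (y - x) * ((x + tau n)^-1 * (x + tau n)^-1 * (y + tau n)^-1 +
             (x + tau n)^-1 * (y + tau n)^-1 * (y + tau n)^-1).
  by field; rewrite A0 B0.
rewrite cabsM -[leRHS]mulrA ler_wpM2l ?cabs_ge0//; apply: le_trans (cabsD _ _) _.
rewrite !cabsM.
have -> : (K1 * K1 * K2 + K1 * K2 * K2) * nu n ^- 3
  = K1 / nu n * (K1 / nu n) * (K2 / nu n) + K1 / nu n * (K2 / nu n) * (K2 / nu n).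
  by field; rewrite lt0r_neq0// nu_gt0.
by apply: lerD; apply: ler_pM => //;
  rewrite ?mulr_ge0 ?cabs_ge0//; apply: ler_pM; rewrite ?cabs_ge0.
Qed.

Lemma nu3_dominated (K : R) (F : int * int -> Cplx R) :
  (forall n, n != (0, 0) -> cabs (F n) <= K * nu n ^- 3) ->
  bounded_sums (fun n => cabs (F n)).
Proof.
move=> F_le; pose L : R := Num.max K 0.
have L0 : 0 <= L by rewrite le_max lexx orbT.
apply: (@bounded_sums_le _ _ (fun n => L * nu n ^- 3) _ [fset (0, 0)]%fset).
- by move=> n; rewrite mulr_ge0// invr_ge0 exprn_ge0// ltW// nu_gt0.
- exact: nu3_bounded.
- move=> n; rewrite inE => n0; apply: le_trans (F_le n n0) _.
  by rewrite ler_wpM2r ?le_max ?lexx// invr_ge0 exprn_ge0// ltW// nu_gt0.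
Qed.

Lemma euler_conv_bounded a : regular a ->
  exists B : R, forall N n, cabs (euler_conv a N n) <= B.
Proof.
move=> /(psi_bounded hw)[B HB]; exists B => N n; rewrite euler_convE.
apply: le_trans (cabs_sum _ _ _) _.
pose h k := (k.1 - n.1, k.2 - n.2); move: (square N) => S.
apply: le_trans (HB [fset h k | k in S]%fset).
rewrite big_imfset//= => -[k1 k2] [l1 l2] _ _ [/addIr -> /addIr ->] //.
Qed.

Lemma euler_conv_cvg a n : regular a -> euler_conv a N n @[N --> \oo] --> g a.
Proof.
move=> a_reg; under eq_fun do rewrite euler_convE.
have hK : cancel (fun k => (k.1 - n.1, k.2 - n.2)) (fun k => (k.1 + n.1, k.2 + n.2)).
  by move=> [k1 k2] /=; rewrite !subrK.
have h'K : cancel (fun k => (k.1 + n.1, k.2 + n.2)) (fun k => (k.1 - n.1, k.2 - n.2)).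
  by move=> [k1 k2] /=; rewrite !addrK.
exact: cvg_comp square_cvg (has_sum_reindex hK h'K (gP hw a_reg)).
Qed.

Lemma weighted_sum_cvg0 (K : R) a (E : int * int -> Cplx R) : regular a -> g a = 0 ->
  (forall n, n != (0, 0) -> cabs (E n) <= K * nu n ^- 3) ->
  \sum_(n <- square N.+1) euler_weight N n * euler_conv a N n * E n @[N --> \oo]
    --> (0 : Cplx R).
Proof.
move=> a_reg ga0 E_le; have [B HB] := euler_conv_bounded a_reg.
have B0 : 0 <= B by apply: le_trans (HB 0%N (0, 0)); exact: cabs_ge0.
have M0 n : 0 <= B * Num.max K 0 * nu n ^- 3.
  by rewrite !mulr_ge0 ?le_max ?lexx ?orbT// invr_ge0 exprn_ge0// ltW// nu_gt0.
pose f N n : Cplx R := if n \in square N.+1 then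
  euler_weight N n * euler_conv a N n * E n else 0.
apply: (@tannery _ _ _ \oo _ f (fun=> 0) _ [fset (0, 0)]%fset _ _ M0).
- exact: nu3_bounded.
- apply: nearW => N n; rewrite inE => n0; rewrite /f; case: ifP => _; last by rewrite cabs0.
  rewrite (cabsM _ (E n)) (cabsM (euler_weight N n)) -[leRHS]mulrA.
  apply: ler_pM; rewrite ?mulr_ge0 ?cabs_ge0//.
    by rewrite -[leRHS]mul1r; apply: ler_pM; rewrite ?cabs_ge0// euler_weight_le.
  apply: le_trans (E_le n n0) _.
  by rewrite ler_wpM2r ?le_max ?lexx// invr_ge0 exprn_ge0// ltW// nu_gt0.
- move=> n; have := cplx_cvgM (euler_conv_cvg n a_reg) (cplx_cvg_cst (E n)).
  rewrite ga0 mul0r => lim0; apply: (@cvg_trans _ (euler_conv a N n * E n @[N --> \oo])); last exact: lim0.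
  have near_f : \forall N \near \oo, euler_conv a N n * E n = f N n.
    exists (`|n.1| + `|n.2|).+1 => // N /= nN; rewrite /f euler_weight_near// mul1r.
    rewrite (_ : n \in square N.+1)// in_square.
    by move: n.1 n.2 nN; clear => n1 n2; lia.
  exact: near_eq_cvg near_f.
- apply: nearW => N; rewrite (_ : \sum_(n <- _) _ = \sum_(n <- square N.+1) f N n).
    by apply: has_sum_fin => n nS; rewrite /f (negPf nS).
  by apply: eq_big_seq => n nS; rewrite /f nS.
- have := @has_sum_fin R _ (fun=> 0) (fset0 : {fset int * int}) (fun _ _ => erefl).
  by rewrite big_seq_fset0.
Qed.

End ProductLimit.

(** * Comparison with the Weierstrass function *)

Section Weierstrass.
Context {R : realType} (w1 w2 : Cplx R).
Hypothesis hw : R_independent w1 w2.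
Implicit Types (n k l : int * int) (x y z a : Cplx R).
Local Notation nu := (@nu R).
Local Notation tau := (lattice_pt w1 w2).
Local Notation regular := (regular w1 w2).
Local Notation chi := (@chi R).
Local Notation g := (inv_sn_sum w1 w2).
Local Notation euler_weight := (@euler_weight R).

Lemma double_series_has_sum (t : int -> int -> Cplx R) (s : Cplx R) :
  has_sum (fun n => t n.1 n.2) s -> double_series t = s.
Proof.
move=> ts; have lim_s : rect_sum t p @[p --> rect_filter] --> s.
  under eq_fun do rewrite rect_sumE.
  exact: (cvg_comp _ _ rect_cvg ts).
by apply: cvg_lim lim_s; exact: norm_hausdorff.
Qed.

Lemma latticeN z : ~ lattice w1 w2 z -> ~ lattice w1 w2 (- z).
Proof.
move=> zL [n1 [n2 zE]]; apply: zL; exists (- n1), (- n2).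
by rewrite -[z]opprK zE; exact: esym (tauN w1 w2 (n1, n2)).
Qed.

(** The reflection n -> -n replaces z - tau by z + tau, and the pole at 0 becomes the term of index
    (0, 0); differences of P then have one formula for all terms. *)
Lemma weierstrass_p_sum z : ~ lattice w1 w2 z ->
  has_sum (fun n => if n == (0, 0) then z ^- 2 else (z + tau n) ^- 2 - tau n ^- 2)
    (weierstrass_p w1 w2 z).
Proof.
move=> zL; have rz := notin_lattice_regular (latticeN zL).
have [K HK] := inv2_diff_le hw rz (regular0 hw).
pose t n := if n == (0, 0) then 0 else (z - tau n) ^- 2 - tau n ^- 2.
have bt : bounded_sums (fun n => cabs (t n)).
  apply: (@nu3_dominated _ K) => n n0; rewrite /t (negPf n0).
  have := HK n n0; rewrite add0r; congr (cabs (_ - _) <= _).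
  by rewrite (_ : - z + tau n = - (z - tau n)) ?sqrrN//; ring.
have st := tsumP bt.
have -> : weierstrass_p w1 w2 z = z ^- 2 + tsum t.
  rewrite /weierstrass_p; congr (_ + _); apply: double_series_has_sum.
  move: st; congr has_sum; apply/funext => -[n1 n2]; rewrite /t /=.
  have -> : (period w1 w2 n1 n2 == 0) = ((n1, n2) == (0, 0)) => [|//].
  apply/idP/idP => [|/eqP[-> ->]]; last exact/eqP/(tau0 w1 w2).
  by apply: contraTT => /(regular0 hw); rewrite add0r.
have NK : cancel (fun n => (- n.1, - n.2)) (fun n : int * int => (- n.1, - n.2)).
  by move=> [n1 n2] /=; rewrite !opprK.
have := @has_sum_fin R _ (fun n => if n == (0, 0) then z ^- 2 else 0) [fset (0, 0)]%fset.
rewrite big_seq_fset1 eqxx => s0.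
have {}s0 : has_sum (fun n => if n == (0, 0) then z ^- 2 else 0) (z ^- 2).
  by apply: s0 => n; rewrite inE => /negPf ->.
have := has_sumD s0 (has_sum_reindex NK NK st); congr has_sum; apply/funext => n.
have -> : t (- n.1, - n.2) = if n == (0, 0) then 0 else (z + tau n) ^- 2 - tau n ^- 2.
  rewrite /t tauN opprK sqrrN; case: n => n1 n2.
  by rewrite !xpair_eqE /= !oppr_eq0.
by case: eqP => _; rewrite ?addr0 ?add0r.
Qed.

Lemma weierstrass_p_diff z z' : ~ lattice w1 w2 z -> ~ lattice w1 w2 z' ->
  has_sum (fun n => (z + tau n) ^- 2 - (z' + tau n) ^- 2)
    (weierstrass_p w1 w2 z - weierstrass_p w1 w2 z').
Proof.
move=> zL z'L; have := has_sumB (weierstrass_p_sum zL) (weierstrass_p_sum z'L).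
congr has_sum; apply/funext => n; case: eqP => [->|_]; last by ring.
by rewrite tau0 !addr0.
Qed.

(** The difference of the single sums at [z] and [z'] tends to 0 because [g a = 0]; only pairs of
    equal denominators survive. *)
Lemma partial_product_diff z z' a : ~ lattice w1 w2 z -> ~ lattice w1 w2 z' ->
  ~ lattice w1 w2 (z + a) -> ~ lattice w1 w2 (z' + a) -> regular a -> g a = 0 ->
  \sum_(k <- square N.+1) \sum_(l <- square N.+1)
    (tau k == a + tau l)%:R *
    (euler_weight N k * euler_weight N l * (chi k * chi l) *
      ((z + tau k) ^- 2 - (z' + tau k) ^- 2)) @[N --> \oo]
    --> g z * g (z + a) - g z' * g (z' + a).
Proof.
move=> zL z'L zaL z'aL a_reg ga0.
have P1 := partial_g_cvg hw (notin_lattice_regular zL).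
have P2 := partial_g_cvg hw (notin_lattice_regular zaL).
have P1' := partial_g_cvg hw (notin_lattice_regular z'L).
have P2' := partial_g_cvg hw (notin_lattice_regular z'aL).
have [K HK] := inv_diff4_le hw (notin_lattice_regular zL) (notin_lattice_regular z'L)
  (notin_lattice_regular (latticeN zaL)) (notin_lattice_regular (latticeN z'aL))
  ltac:(ring).
have W := weighted_sum_cvg0 hw a_reg ga0 HK.
have := cplx_cvgB (cplx_cvgB (cplx_cvgM P1 P2) (cplx_cvgM P1' P2')) W.
move=> /(_ _ _ _ _)/wrap[]; rewrite subr0 => lim0.
refine (cplx_near_cvg _ lim0); apply: nearW => N /=.
rewrite (finite_product N (notin_lattice zL) (notin_lattice zaL)).
rewrite (finite_product N (notin_lattice z'L) (notin_lattice z'aL)).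
have diag (x : Cplx R) k l : (x + tau k == x + a + tau l) = (tau k == a + tau l).
  by rewrite -(addrA x a) (inj_eq (addrI x)).
pose U (x : Cplx R) := \sum_(n <- square N.+1) euler_weight N n *
  euler_conv w1 w2 a N n * ((x + tau n)^-1 - (x + a - tau n)^-1).
pose D (x : Cplx R) := \sum_(k <- square N.+1) \sum_(l <- square N.+1)
  (x + tau k == x + a + tau l)%:R *
  (euler_weight N k * euler_weight N l * (chi k * chi l) * (x + tau k) ^- 2).
rewrite -/(U z) -/(U z') -/(D z) -/(D z').
have -> : \sum_(k <- square N.+1) \sum_(l <- square N.+1) (tau k == a + tau l)%:R *
    (euler_weight N k * euler_weight N l * (chi k * chi l) *
      ((z + tau k) ^- 2 - (z' + tau k) ^- 2)) = D z - D z'.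
  rewrite /D -sumrB; apply: eq_bigr => k _; rewrite -sumrB.
  by apply: eq_bigr => l _; rewrite !diag; ring.
have -> : \sum_(n <- square N.+1) euler_weight N n * euler_conv w1 w2 a N n *
    ((z + tau n)^-1 - (z' + tau n)^-1 +
      ((- (z + a) + tau n)^-1 - (- (z' + a) + tau n)^-1)) = U z - U z'.
  rewrite /U -sumrB; apply: eq_bigr => n _.
  rewrite (_ : - (z + a) + tau n = - (z + a - tau n)); last by ring.
  rewrite (_ : - (z' + a) + tau n = - (z' + a - tau n)); last by ring.
  by rewrite !invrN; ring.
by ring.
Qed.

(** For [a] outside the lattice no two denominators are equal, so nothing survives. *)
Lemma g_mul_const z z' a : ~ lattice w1 w2 z -> ~ lattice w1 w2 z' ->
  ~ lattice w1 w2 (z + a) -> ~ lattice w1 w2 (z' + a) -> ~ lattice w1 w2 a ->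
  g a = 0 -> g z * g (z + a) = g z' * g (z' + a).
Proof.
move=> zL z'L zaL z'aL aL ga0.
have lim1 := partial_product_diff zL z'L zaL z'aL (notin_lattice_regular aL) ga0.
apply/eqP; rewrite -subr_eq0; apply/eqP.
apply: cvg_unique lim1 _; first exact: norm_hausdorff.
refine (cplx_near_cvg _ (@cplx_cvg_cst R nat \oo _ 0)); apply: nearW => N.
rewrite big1// => k _; rewrite big1// => l _.
rewrite (_ : (_ == _) = false) ?mul0r//; apply/negP => /eqP kl.
have := notin_lattice aL (l.1 - k.1, l.2 - k.2).
by rewrite tauB kl => /eqP; apply; ring.
Qed.

(** The case a = 0: the surviving pairs are k = l, the signs square to 1, and the squared weights
    tend to 1 under the summable majorant of the differences of P. *)
Lemma g_sqr_diff z z' : ~ lattice w1 w2 z -> ~ lattice w1 w2 z' ->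
  g z ^+ 2 - g z' ^+ 2 = weierstrass_p w1 w2 z - weierstrass_p w1 w2 z'.
Proof.
move=> zL z'L; have zL0 : ~ lattice w1 w2 (z + 0) by rewrite addr0.
have z'L0 : ~ lattice w1 w2 (z' + 0) by rewrite addr0.
have := partial_product_diff zL z'L zL0 z'L0 (regular0 hw) (g0 hw).
rewrite !addr0 -!expr2 => lim1.
apply: cvg_unique lim1 _; first exact: norm_hausdorff.
have [K HK] := inv2_diff_le hw (notin_lattice_regular zL) (notin_lattice_regular z'L).
pose q n : Cplx R := (z + tau n) ^- 2 - (z' + tau n) ^- 2.
pose f N n : Cplx R := if n \in square N.+1 then euler_weight N n ^+ 2 * q n else 0.
have M0 n : 0 <= Num.max K 0 * nu n ^- 3.
  by rewrite mulr_ge0 ?le_max ?lexx ?orbT// invr_ge0 exprn_ge0// ltW// nu_gt0.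
apply: (@tannery _ _ _ \oo _ f q _ [fset (0, 0)]%fset _ _ M0).
- exact: nu3_bounded.
- apply: nearW => N n; rewrite inE => n0; rewrite /f; case: ifP => _; last by rewrite cabs0.
  apply: (@le_trans _ _ (cabs (q n))).
    rewrite cabsM ler_piMl ?cabs_ge0// cabsX expr_le1 ?cabs_ge0// euler_weight_le //.
  apply: le_trans (HK n n0) _.
  by rewrite ler_wpM2r ?le_max ?lexx// invr_ge0 exprn_ge0// ltW// nu_gt0.
- move=> n; refine (cplx_near_cvg _ (@cplx_cvg_cst R nat \oo _ (q n))).
  have near_f : \forall N \near \oo, q n = f N n.
    exists (`|n.1| + `|n.2|).+1 => // N /= nN.
    rewrite /f euler_weight_near// expr1n mul1r.
    rewrite (_ : n \in square N.+1)// in_square.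
    by move: n.1 n.2 nN; clear => n1 n2; lia.
  exact: near_f.
- apply: nearW => N; rewrite (_ : \sum_(k <- _) _ = \sum_(n <- square N.+1) f N n).
    by apply: has_sum_fin => n nS; rewrite /f (negPf nS).
  rewrite /f; move: (square N.+1) => S.
  apply: eq_big_seq => k kS; rewrite kS (big_fsetD1 k)//= add0r eqxx mul1r.
  rewrite big1_fset ?addr0; first by rewrite chi_sqr /q; ring.
  move=> l; rewrite !inE => /andP[lk _] _; rewrite add0r.
  rewrite (_ : (_ == _) = false) ?mul0r//; apply/negP => /eqP kl.
  have : (k.1 - l.1, k.2 - l.2) != (0, 0).
    apply: contra_neq lk; case: k l {kS kl} => [k1 k2] [l1 l2] [/eqP + /eqP].
    by rewrite !subr_eq0 => /eqP -> /eqP ->.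
  by move=> /(regular0 hw); rewrite tauB kl subrr add0r eqxx.
- exact: weierstrass_p_diff.
Qed.

End Weierstrass.

(** * Connectedness of the complement of the half-lattice *)

Section Connectedness.
Context {R : realType} (w1 w2 : Cplx R).
Hypothesis hw : R_independent w1 w2.
Implicit Types x y z a : Cplx R.
Local Notation lattice := (lattice w1 w2).
Local Notation rc := (@real_complex R : R -> Cplx R).

Definition locally_constant_on (U P : set (Cplx R)) :=
  (forall z, U z -> P z -> \forall y \near z, P y) /\
  (forall z, U z -> ~ P z -> \forall y \near z, ~ P y).

(** Pulled back to the parameter of the line, [P] becomes an open and closed subset of the connected
    real line. *)
Lemma locally_constant_line (U P : set (Cplx R)) (c d : Cplx R) :
  locally_constant_on U P -> (forall t : R, U (c + rc t * d)) ->
  forall s t : R, P (c + rc s * d) -> P (c + rc t * d).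
Proof.
move=> [P_open P_closed] UU s t Ps.
have open_line (Q : set (Cplx R)) :
    (forall z, U z -> Q z -> \forall y \near z, Q y) ->
    open [set r : R | Q (c + rc r * d)].
  move=> Q_open; rewrite openE => r /= Qr.
  have /nbhs_cabs[e e0 eQ] := Q_open _ (UU r) Qr.
  apply/nbhs_ballP; exists (e / (cabs d + 1)) => /=.
    by rewrite divr_gt0// ltr_wpDl// cabs_ge0.
  move=> r'; rewrite /ball/= => rr'; apply: eQ.
  rewrite (_ : _ - _ = rc (r' - r) * d); last by rewrite rmorphB; ring.
  rewrite cabsM cabs_real distrC.
  move: rr'; rewrite ltr_pdivlMr; last by rewrite ltr_wpDl// cabs_ge0.
  by apply: le_lt_trans; rewrite ler_wpM2l// lerDl.
have conn : connected [set: R] by apply/connected_intervalP.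
suff : [set r : R | P (c + rc r * d)] = [set: R].
  by move=> /seteqP[_ /(_ t I)].
apply: conn.
- by exists s.
- by exists [set r : R | P (c + rc r * d)]; [exact: open_line|rewrite setTI].
- exists [set r : R | P (c + rc r * d)]; last by rewrite setTI.
  rewrite -[X in closed X]setCK; apply: open_closedC.
  exact: (open_line (~` P)).
Qed.

Lemma coordinates z : exists s t : R, z = rc s * w1 + rc t * w2.
Proof.
have := wronskian_neq0 hw; case: z w1 w2 => [x y] [a b] [c d] /= D0.
exists ((y * c - x * d) / (b * c - a * d)), ((b * x - a * y) / (b * c - a * d)).
by apply/eqP; rewrite eq_complex /= !mul0r !subr0 !addr0; apply/andP; split; apply/eqP; field.
Qed.

Lemma double_in_lattice (s t : R) : lattice (2 * (rc s * w1 + rc t * w2)) ->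
  exists n1 n2 : int, s = n1%:~R / 2 /\ t = n2%:~R / 2.
Proof.
move=> [n1 [n2 st]]; exists n1, n2.
have [|s0 t0] := hw (s := 2 * s - n1%:~R) (t := 2 * t - n2%:~R); last by split; lra.
move: st; rewrite /period => /eqP; rewrite -subr_eq0 => /eqP <-.
by rewrite !rmorphB !rmorphM !rmorph_int rmorph_nat/=; ring.
Qed.

Lemma quarter_not_half (n : int) : 4^-1 <> n%:~R / 2 :> R.
Proof.
move=> n4; have : (n * 2)%:~R = 1%:~R :> R by rewrite intrM; lra.
by move=> /intr_inj; lia.
Qed.

(* Any point of this set lies on a full line s = const or t = const contained in
   it, and all these lines meet one of the two lines through (1/4, 1/4). *)
Lemma half_lattice_connected (P : set (Cplx R)) :
  locally_constant_on [set z | ~ lattice (2 * z)] P ->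
  forall z z', ~ lattice (2 * z) -> ~ lattice (2 * z') -> P z -> P z'.
Proof.
move=> locP; pose pt (s t : R) := rc s * w1 + rc t * w2.
have vert s : (forall n : int, s <> n%:~R / 2) -> forall t t', P (pt s t) -> P (pt s t').
  move=> s_half t t'; apply: (locally_constant_line locP) => r /=.
  by move=> /double_in_lattice[n1 [n2 [sn _]]]; exact: (s_half n1).
have horiz t : (forall n : int, t <> n%:~R / 2) -> forall s s', P (pt s t) -> P (pt s' t).
  move=> t_half s s'; rewrite /pt addrC [X in _ -> P X]addrC.
  apply: (locally_constant_line locP) => r /=; rewrite addrC.
  by move=> /double_in_lattice[n1 [n2 [_ tn]]]; exact: (t_half n2).
have q := quarter_not_half.
have base z : ~ lattice (2 * z) -> P z <-> P (pt 4^-1 4^-1).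
  have [s [t ->]] := coordinates z; rewrite -/(pt s t) => zU.
  have [s_half|] := pselect (forall n : int, s <> n%:~R / 2).
    split=> H; first exact: horiz q _ _ (vert _ s_half t _ H).
    exact: vert s_half _ _ (horiz _ q _ s H).
  move=> /existsNP[n1 /contrapT sn].
  have t_half (n2 : int) : t <> n2%:~R / 2.
    move=> tn; apply: zU; exists n1, n2; rewrite /pt sn tn /period.
    by rewrite !fmorph_div !rmorph_int rmorph_nat/=; field.
  split=> H; first exact: vert q _ _ (horiz _ t_half s _ H).
  exact: horiz t_half _ _ (vert _ q _ t H).
by move=> z z' zU z'U /(base _ zU)/(base _ z'U).
Qed.

End Connectedness.

(** * Zeros of g and uniqueness of the branch *)

Section InverseSineBranch.
Context {R : realType} (w1 w2 : Cplx R).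
Hypothesis hw : R_independent w1 w2.
Implicit Types (n : int * int) (x y z a : Cplx R) (h : Cplx R -> Cplx R).
Local Notation lattice := (lattice w1 w2).
Local Notation tau := (lattice_pt w1 w2).
Local Notation g := (inv_sn_sum w1 w2).

Lemma double_lattice z : ~ lattice (2 * z) -> ~ lattice z.
Proof.
move=> zL [n1 [n2 zE]]; apply: zL; exists (n1 * 2), (n2 * 2).
by rewrite zE /period !rmorphM/=; ring.
Qed.

Lemma half_period_notin_lattice : ~ lattice (w2 / 2).
Proof.
move=> [n1 [n2 n12]]; apply: (@quarter_not_half R n2).
have [|_ n2h] := hw (s := n1%:~R) (t := n2%:~R - 2^-1); last by lra.
rewrite rmorphB fmorphV !rmorph_int rmorph_nat/= mulrBl addrA.
by rewrite -[n1%:~R * w1 + _]n12; field.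
Qed.

(** The reflection (n1, n2) -> (-n1, -n2 - 1) changes the sign of w2/2 + tau and keeps (-1)^n1, so
    the odd function [psi] makes the sum its own opposite. *)
Lemma g_half_period : g (w2 / 2) = 0.
Proof.
have reg := notin_lattice_regular half_period_notin_lattice.
pose h n : int * int := (- n.1, - n.2 - 1).
have hK : cancel h h by case=> n1 n2; rewrite /h /=; congr (_, _); ring.
have tau_h n : w2 / 2 + tau (h n) = - (w2 / 2 + tau n).
  by rewrite /h /lattice_pt /period /= rmorphB !rmorphN/=; field.
have := has_sum_reindex hK hK (gP hw reg).
have := @has_sumZ _ _ (-1) _ _ (gP hw reg); rewrite mulN1r.
move=> sN s1; have /eqP : - g (w2 / 2) = g (w2 / 2).
  apply: has_sum_unique sN _; move: s1; congr has_sum; apply/funext => n.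
  have chi_h : chi (h n) = chi n :> Cplx R by exact: chiN.
  by rewrite chi_h tau_h psiN mulN1r mulrN.
by rewrite eq_sym -addr_eq0 -mulr2n mulrn_eq0 /= => /eqP.
Qed.

Lemma g_sqr z : ~ lattice z ->
  g z ^+ 2 = weierstrass_p w1 w2 z - weierstrass_p w1 w2 (w2 / 2).
Proof.
move=> zL; rewrite -(g_sqr_diff hw zL half_period_notin_lattice).
by rewrite g_half_period expr0n subr0.
Qed.

Lemma notin_lattice_near z : ~ lattice z -> \forall y \near z, ~ lattice y.
Proof.
move=> zL; have z0 : z != 0 by have := notin_lattice zL (0, 0); rewrite tau0 addr0.
have near0 : \forall y \near z, y != 0.
  apply/nbhs_cabs; exists (cabs z); first by rewrite cabs_gt0.
  by move=> y; apply: contraTneq => ->; rewrite sub0r cabsN ltxx.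
apply: filterS2 near0 (regular_near hw (notin_lattice_regular zL)) => y y0 y_reg.
move=> [n1 [n2 yE]]; have [n0|] := eqVneq (- n1, - n2) (0, 0).
  move: n0 y0 => [/eqP + /eqP]; rewrite !oppr_eq0 yE => /eqP -> /eqP ->.
  by rewrite -/(tau (0, 0)) tau0 eqxx.
by move=> /y_reg; rewrite (tauN w1 w2 (n1, n2)) yE subrr eqxx.
Qed.

Lemma notin_lattice_near0 (c : Cplx R) : c != 0 ->
  \forall z \near (0 : Cplx R)^', ~ lattice (c * z).
Proof.
move=> c0; have /nbhs_cabs[e e0 reg] := regular_near hw (regular0 hw).
have near_reg : \forall z \near (0 : Cplx R), regular w1 w2 (c * z).
  apply/nbhs_cabs; exists (e / cabs c); first by rewrite divr_gt0// cabs_gt0.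
  move=> z; rewrite subr0 ltr_pdivlMr ?cabs_gt0// mulrC -cabsM => cz.
  by apply: reg; rewrite subr0.
near=> z; have z0 : z != 0 by near: z; exact: nbhs_dnbhs_neq.
have : regular w1 w2 (c * z) by near: z; exact: nbhs_dnbhs.
move=> z_reg [n1 [n2 zE]]; have [n0|] := eqVneq (- n1, - n2) (0, 0).
  have : c * z != 0 by rewrite mulf_neq0.
  move: n0 => [/eqP + /eqP]; rewrite !oppr_eq0 zE => /eqP -> /eqP ->.
  by rewrite -/(tau (0, 0)) tau0 eqxx.
by move=> /z_reg; rewrite (tauN w1 w2 (n1, n2)) zE subrr eqxx.
Unshelve. all: by end_near.
Qed.

Lemma pole_near h : z * h z @[z --> 0^'] --> (1 : Cplx R) ->
  \forall z \near (0 : Cplx R)^', cabs (z * h z - 1) < 1.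
Proof. by move=> /cvg_cabsP/(_ 1 ltr01). Qed.

Lemma pole_neq0 h : z * h z @[z --> 0^'] --> (1 : Cplx R) ->
  \forall z \near (0 : Cplx R)^', h z != 0.
Proof.
move=> /pole_near; apply: filterS => z; apply: contraTneq => ->.
by rewrite mulr0 sub0r cabsN cabs1 ltxx.
Qed.

Lemma dnbhs0_shift z (P : Cplx R -> Prop) :
  (\forall y \near (0 : Cplx R)^', P y) -> P 0 -> \forall y \near z, P (y - z).
Proof.
move=> nearP P0; have /nbhs_cabs[e e0 He] : \forall y \near (0 : Cplx R), y != 0 -> P y.
  exact: nearP.
apply/nbhs_cabs; exists e => // y yz; have [->//|yz0] := eqVneq (y - z) 0.
by apply: He => //; rewrite subr0.
Qed.

(* If g a = 0 then g z * g (z + a) does not depend on z; its value at z = a is 0,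
   and g has no zero near 0, so g vanishes near a. By connectedness g would vanish
   identically. *)
Lemma g_neq0 a : ~ lattice (2 * a) -> g a != 0.
Proof.
move=> aL2; apply/negP => /eqP ga.
have loc : locally_constant_on [set z | ~ lattice (2 * z)] [set z | g z = 0].
  split=> z /= zL2 gz; have zL := double_lattice zL2.
    have near0 : \forall y \near (0 : Cplx R)^', ~ lattice y /\ g y != 0.
      have := notin_lattice_near0 (oner_neq0 (Cplx R)).
      apply: filterS2 (pole_neq0 (g_pole hw)) => y gy; rewrite mul1r.
      by split.
    have {}near0 : \forall y \near z, y - z != 0 -> ~ lattice (y - z) /\ g (y - z) != 0.
      apply: (@dnbhs0_shift z (fun y => y != 0 -> ~ lattice y /\ g y != 0)).
        by apply: filterS near0 => y.
      by rewrite eqxx.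
    apply: filterS2 near0 (notin_lattice_near zL) => y yz yL.
    have [/eqP|yz0] := eqVneq (y - z) 0; first by rewrite subr_eq0 => /eqP ->.
    have [yzL gyz] := yz yz0.
    have zzL : ~ lattice (z + z) by rewrite -mulr2n -mulr_natl.
    have yL' : ~ lattice (y - z + z) by rewrite subrK.
    have := g_mul_const hw yzL zL yL' zzL zL gz.
    by rewrite subrK gz mul0r => /eqP; rewrite mulf_eq0 (negPf gyz) => /eqP.
  have /cvg_cabsP/(_ (cabs (g z))) := g_cvg hw zL.
  rewrite cabs_gt0 => /(_ (introN eqP gz)); apply: filterS => y gy gy0.
  by move: gy; rewrite gy0 sub0r cabsN ltxx.
have two0 : 2 != 0 :> Cplx R by rewrite pnatr_eq0.
have [z [zL gz]] := filter_ex (filterI (notin_lattice_near0 two0) (pole_neq0 (g_pole hw))).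
have := half_lattice_connected hw loc aL2 zL ga.
by move=> /eqP; rewrite (negPf gz).
Qed.

Lemma g_branch : inv_sn_branch w1 w2 g.
Proof.
split=> [z zL|z zL|]; [exact: g_sqr|exact: g_cvg|exact: g_pole].
Qed.

Lemma inv_sn_branch_unique h : inv_sn_branch w1 w2 h ->
  forall z, ~ lattice z -> h z = g z.
Proof.
move=> [h_sqr h_cont h_pole].
have hg z : ~ lattice z -> h z = g z \/ h z = - g z.
  move=> zL; have /eqP : h z ^+ 2 = g z ^+ 2 by rewrite h_sqr// g_sqr.
  by rewrite eqf_sqr => /orP[] /eqP; [left|right].
have diff_cvg z : ~ lattice z -> h y - g y @[y --> z] --> h z - g z.
  by move=> zL; exact: cplx_cvgB (h_cont z zL) (g_cvg hw zL).
have neq_open z : ~ lattice z -> h z <> g z -> \forall y \near z, h y <> g y.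
  move=> zL hgz; have /cvg_cabsP/(_ (cabs (h z - g z))) := diff_cvg z zL.
  rewrite cabs_gt0 subr_eq0 => /(_ (introN eqP hgz)); apply: filterS => y hgy hy.
  by move: hgy; rewrite hy subrr sub0r cabsN ltxx.
(* Agreement is open because g z is nonzero: at a nearby point with h = -g, the difference h - g =
   -2 g could not be small. *)
have loc : locally_constant_on [set z | ~ lattice (2 * z)] [set z | h z = g z].
  split=> z /= zL2 hgz; have zL := double_lattice zL2; last exact: neq_open.
  have gz := g_neq0 zL2; have gz0 : 0 < cabs (g z) by rewrite cabs_gt0.
  have e0 : 0 < cabs (g z) / 2 by lra.
  have /cvg_cabsP/(_ _ gz0) near_h := diff_cvg z zL.
  have /cvg_cabsP/(_ _ e0) near_g := g_cvg hw zL.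
  apply: filterS3 near_h near_g (notin_lattice_near zL) => y hy gy yL.
  have [//|hyg] := hg y yL; move: hy; rewrite hgz subrr subr0 hyg.
  rewrite (_ : - g y - g y = - (2 * g y)); last by ring.
  rewrite cabsN cabsM cabs_nat => hy.
  have := cabs_ge (g z) (g y - g z); rewrite [g z + _]addrC subrK; lra.
have two0 : 2 != 0 :> Cplx R by rewrite pnatr_eq0.
(* Near 0 both z h and z g are at distance less than 1 from 1, whereas h = -g would make the two
   errors add up to -2. *)
have [z0 [z0L hgz0]] : exists z, ~ lattice (2 * z) /\ h z = g z.
  have [z [zL2 [hz gz]]] := filter_ex (filterI (notin_lattice_near0 two0)
    (filterI (pole_near h_pole) (pole_near (g_pole hw)))); exists z; split=> //.
  have [//|hgz] := hg z (double_lattice zL2); exfalso.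
  have := cabsD (z * h z - 1) (z * g z - 1).
  rewrite (_ : z * h z - 1 + (z * g z - 1) = - 2%:R); last by rewrite hgz; ring.
  by rewrite cabsN cabs_nat; lra.
have on_U z : ~ lattice (2 * z) -> h z = g z.
  by move=> zL; exact: (half_lattice_connected hw loc z0L zL hgz0).
(* At the remaining half-periods disagreement would spread to a neighbourhood, which contains points
   z + y with 2 (z + y) outside the lattice. *)
move=> z zL; have [zL2|zL2] := pselect (lattice (2 * z)); last exact: on_U.
apply: contrapT => hgz; have /nbhs_cabs[e e0 He] := neq_open z zL hgz.
have near0 : \forall y \near (0 : Cplx R)^', cabs y < e.
  by apply: nbhs_dnbhs; apply/nbhs_cabs; exists e => // y; rewrite subr0.
have [y [yL ye]] := filter_ex (filterI (notin_lattice_near0 two0) near0).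
apply: (He (z + y)); first by rewrite addrAC subrr add0r.
apply: on_U; rewrite mulrDr; move: zL2 => [n1 [n2 ->]] [k1 [k2 nk]].
apply: yL; exists (k1 - n1), (k2 - n2).
have := tauB w1 w2 (n1, n2) (k1, k2); rewrite /lattice_pt/= => ->.
by rewrite -nk; ring.
Qed.

Lemma elliptic_sn_inv z : ~ lattice z -> 1 / elliptic_sn w1 w2 z = g z.
Proof.
move=> zL; rewrite /elliptic_sn div1r invrK.
apply: inv_sn_branch_unique zL; apply: (@getPex _ (inv_sn_branch w1 w2)).
by exists g; exact: g_branch.
Qed.

End InverseSineBranch.

(** * The expectation of the fields as formal series *)

Section VacuumSeries.
Context {R : realType} (m : nat) (A B C : 'M[Cplx R]_m) (a1 a2 : Cplx R)
  (b c : 'I_m -> Cplx R) (v w : 'I_m -> 'cV[Cplx R]_m) (u : 'cV[Cplx R]_m)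
  (w1 w2 : Cplx R) (Q : Cplx R -> Cplx R -> {symmetric 'cV[Cplx R]_m}).
Hypothesis hw : R_independent w1 w2.
Hypothesis hABC : operators A B C a1 a2 b c v w u.
Hypothesis hgen : generic_eigenvalues w1 w2 a2 b c.
Hypothesis hQ12 : forall n1 n2 : int,
  is_symprod a2 b c v w (n1%:~R * w1) (n2%:~R * w2) (Q (n1%:~R * w1) (n2%:~R * w2)).
Hypothesis hQ21 : forall n1 n2 : int,
  is_symprod a2 b c v w (n2%:~R * w2) (n1%:~R * w1) (Q (n2%:~R * w2) (n1%:~R * w1)).

Lemma vev_series (eps eps' : Cplx R) (i j : 'I_m) : eps * eps' = 1 ->
  vev_series_eq w1 w2 u Q
    (fun k1 k2 => foo w1 w2 a2 b c v w eps j (- k1) (- k2))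
    (fun n1 n2 => f0 w1 w2 a2 b c v eps' i n1 n2)
    (constant_series (1 / elliptic_sn w1 w2 (a2 + b i - c j))).
Proof.
move=> eps1 k1 k2; rewrite /double_series_to /constant_series.
(* The modes paired in the coefficient of index k lie in the summands -p and k - p, which are
   orthogonal unless k = 0. *)
case: ifPn => [/andP[/eqP -> /eqP ->]|k0]; last first.
  refine (cplx_near_cvg _ (cplx_cvg_cst 0)); apply: nearW => p.
  rewrite /rect_sum big1// => n1 _; rewrite big1// => n2 _.
  rewrite vev_foo_f0_eq0//; apply: contra k0 => /eqP[].
  by rewrite -[LHS]add0r => /addIr <- /(congr1 (+%R^~ (n2%:Z - p.2.1%:Z)));
    rewrite addNr subrK => <-.
set x := a2 + b i - c j.
have xL : ~ lattice w1 w2 x.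
  move=> [n1 [n2 xE]]; have := gen_abc hgen i j (- n1) (- n2).
  rewrite -/x xE (_ : period w1 w2 (- n1) (- n2) = - period w1 w2 n1 n2).
    by rewrite subrr eqxx.
  exact: (tauN w1 w2 (n1, n2)).
rewrite elliptic_sn_inv//.
(* The mode index is the opposite of the summation index, so the terms are those of -g(-x), which is
   g(x) by oddness. *)
have := cplx_cvgM (cplx_cvg_cst (-1)) (rect_sum_g hw (latticeN xL)).
rewrite (gN hw (notin_lattice_regular xL)) mulrNN mul1r => lim.
refine (cplx_near_cvg _ (lim _ _)); apply: nearW => p; rewrite /rect_sum mulr_sumr.
apply: eq_bigr => n1 _; rewrite mulr_sumr; apply: eq_bigr => n2 _.
pose k := (n1%:Z - p.1.1%:Z, n2%:Z - p.2.1%:Z); rewrite !sub0r.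
rewrite -[n1%:Z - _]/k.1 -[n2%:Z - _]/k.2.
rewrite (vev_foo_f0 hw hABC hgen hQ12 hQ21 _ _ _ _ eps1) -/x.
have chi_k : (-1) ^ (- k.1) = chi k :> Cplx R by exact: chiN.
have tau_k : period w1 w2 (- k.1) (- k.2) = - lattice_pt w1 w2 k by exact: tauN.
rewrite chi_k tau_k -/(lattice_pt w1 w2 k) -/(chi k).
rewrite (_ : x - lattice_pt w1 w2 k = - (- x + lattice_pt w1 w2 k)); last by ring.
by rewrite !invrN; ring.
Qed.

End VacuumSeries.

Theorem theorem2p6 (R : realType) (m : nat) (A B C : 'M[Cplx R]_m)
    (a1 a2 : Cplx R) (b c : 'I_m -> Cplx R)
    (v w : 'I_m -> 'cV[Cplx R]_m) (u : 'cV[Cplx R]_m)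
    (w1 w2 : Cplx R)
    (Q : Cplx R -> Cplx R -> {symmetric 'cV[Cplx R]_m})
    (hm : (1 < m)%N)
    (hw : R_independent w1 w2)
    (hABC : operators A B C a1 a2 b c v w u)
    (hgen : generic_eigenvalues w1 w2 a2 b c)
    (hQ12 : forall n1 n2 : int,
      is_symprod a2 b c v w (n1%:~R * w1) (n2%:~R * w2)
        (Q (n1%:~R * w1) (n2%:~R * w2)))
    (hQ21 : forall n1 n2 : int,
      is_symprod a2 b c v w (n2%:~R * w2) (n1%:~R * w1)
        (Q (n2%:~R * w2) (n1%:~R * w1))) :
  forall i j : 'I_m,
    vev_series_eq w1 w2 u Q
      (Foo_dag w1 w2 a2 b c v w j) (F0 w1 w2 a2 b c v i)
      (constant_series (1 / elliptic_sn w1 w2 (a2 + b i - c j))) /\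
    vev_series_eq w1 w2 u Q
      (Foo w1 w2 a2 b c v w j) (F0_dag w1 w2 a2 b c v i)
      (constant_series (1 / elliptic_sn w1 w2 (a2 + b i - c j))).
Proof.
move=> i j; split.
  by apply: (vev_series hw hABC hgen hQ12 hQ21); rewrite mulNr -expr2 sqrCi opprK.
by apply: (vev_series hw hABC hgen hQ12 hQ21); rewrite mulrN -expr2 sqrCi opprK.
Qed.
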